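(* Let $T>0$, $s\ge 1$, and let $u_T\in H^s(\mathbb{R})$ be such that its Fourier transform $\hat u_T$ has compact support. Let $u(t,x)=\int_{\mathbb{R}}e^{-ix\eta}e^{\eta^2(T-t)}\hat u_T(\eta)\,d\eta$, $0\le t\le T$, be the solution of the backward heat problem $\partial_t u=\partial_{xx}u$ on $\mathbb{R}$ for $0\le t<T$, $u(T,\cdot)=u_T$, and write $u_0=u(0,\cdot)$. Let $\eta_{\max}>0$ and set $$\delta(\eta_{\max})=\Big(\int_{|\eta|>\eta_{\max}}(1+\eta^2)^s|\hat u_0(\eta)|^2\,d\eta\Big)^{1/2}.$$ Let $\chi_{\max}$ be the indicator function of $[-\eta_{\max},\eta_{\max}]$ and $$w_{\eta_{\max}}(t,x,p)=\int_{\mathbb{R}}e^{-|p+\eta^2(t-T)|}\hat u_T(\eta)\chi_{\max}(\eta)e^{-ix\eta}\,d\eta .$$ Define $u_{\eta_{\max}}(t,x,p)$ by either one of the two formulas $$u_{\eta_{\max}}(t,x,p)=e^{p}\,w_{\eta_{\max}}(t,x,p)\qquad\text{or}\qquad u_{\eta_{\max}}(t,x,p)=e^{p}\int_p^\infty w_{\eta_{\max}}(t,x,q)\,dq .$$ Then for every $p>p^{\Diamond}:=\eta_{\max}^2T$ and every $t\in[0,T)$, $$\|u(t,\cdot)-u_{\eta_{\max}}(t,\cdot,p)\|_{L^2(\mathbb{R})}\le \frac{e^{-\eta_{\max}^2t}\,\delta(\eta_{\max})}{\eta_{\max}^s}.$$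
   Context: Fourier convention: $\hat g(\eta)=\frac1{2\pi}\int_{\mathbb{R}}e^{ix\eta}g(x)\,dx$, $g(x)=\int_{\mathbb{R}}e^{-ix\eta}\hat g(\eta)\,d\eta$. Norms are defined on the Fourier side: $\|g\|_{H^s(\mathbb{R})}=\big(\int_{\mathbb{R}}|\hat g(\eta)|^2(1+\eta^2)^s\,d\eta\big)^{1/2}$, and $\|\cdot\|_{L^2(\mathbb{R})}$ denotes this norm with $s=0$, i.e. $\|g\|_{L^2(\mathbb{R})}=\|\hat g\|_{L^2(d\eta)}$ (no factor $2\pi$). The index $s$ may be noninteger. *)

(* Defs.v *)
From HB Require Import structures.
From mathcomp Require Import all_boot all_order all_algebra.
From mathcomp Require Import all_classical all_reals all_analysis.
From mathcomp Require Import complex.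

Set Implicit Arguments.
Unset Strict Implicit.
Unset Printing Implicit Defensive.

Import Order.TTheory GRing.Theory Num.Theory.
Import numFieldNormedType.Exports.

Local Open Scope classical_set_scope.
Local Open Scope ring_scope.
Local Open Scope complex_scope.
Import Normc.

Section defs.
Context {R : realType}.
Implicit Types (g h : R -> R[i]) (T s M t x p : R).

Notation mu := (@lebesgue_measure R).

Definition cexpi (theta : R) : R[i] := cos theta +i* sin theta.

(* Meaningful when the real and imaginary parts of f are integrable on D. *)
Definition cintegral (D : set R) (f : R -> R[i]) : R[i] :=
  (\int[mu]_(x in D) complex.Re (f x)) +i* (\int[mu]_(x in D) complex.Im (f x)).

Definition L2 g : Prop :=
  [/\ measurable_fun setT (fun x => complex.Re (g x)),
      measurable_fun setT (fun x => complex.Im (g x)) &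
      (\int[mu]_x (normc (g x) ^+ 2)%:E < +oo)%E].

Definition fourier_trunc (N : R) g (eta : R) : R[i] :=
  ((2 * pi)^-1)%:C * cintegral `[- N, N] (fun x => cexpi (x * eta) * g x).

(* The integral (2 pi)^-1 \int e^{i x eta} g(x) dx need not converge absolutely
   for g in L^2: it is read, as in Plancherel's theorem, as the limit in
   L^2(d eta) of the integrals over [-N, N]. *)
Definition is_fourier g h : Prop :=
  L2 h /\
  (\int[mu]_eta (normc (fourier_trunc n%:R g eta - h eta) ^+ 2)%:E)%E
    @[n --> \oo] --> 0%E.

(* A representative of the Fourier transform, which is unique only up to
   null sets; by Plancherel's theorem it exists for all g in L^2, so that the
   default value 0 is not used there. *)
Definition fourier g : R -> R[i] := xget (fun=> 0) [set h | is_fourier g h].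

Definition weighted_norm (D : set R) s h : \bar R :=
  sqrte (\int[mu]_(eta in D) (normc (h eta) ^+ 2 * (1 + eta ^+ 2) `^ s)%:E)%E.

(* For s >= 0, where H^s is contained in L^2; +oo outside L^2. *)
Definition Hs_norm s g : \bar R :=
  if `[< L2 g >] then weighted_norm setT s (fourier g) else +oo%E.

Definition L2_norm g : \bar R := Hs_norm 0 g.

Definition in_Hs s g : Prop := (Hs_norm s g < +oo)%E.

(* Compactness of the essential support: the pointwise support depends on the
   representative. *)
Definition compactly_supported h : Prop :=
  exists2 K : set R, compact K & {ae mu, forall eta, ~ K eta -> h eta = 0}.

Definition heat_backward T (uT : R -> R[i]) t x : R[i] :=
  cintegral setT (fun eta =>
    cexpi (- (x * eta)) * (expR (eta ^+ 2 * (T - t)))%:C * fourier uT eta).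

Definition delta T s (uT : R -> R[i]) M : \bar R :=
  weighted_norm [set eta | M < `|eta|] s (fourier (heat_backward T uT 0)).

Definition w_max T (uT : R -> R[i]) M t x p : R[i] :=
  cintegral setT (fun eta =>
    (expR (- `|p + eta ^+ 2 * (t - T)|))%:C * fourier uT eta *
    (\1_(`[- M, M]%classic) eta)%:C * cexpi (- (x * eta))).

Definition u_max_point T (uT : R -> R[i]) M t x p : R[i] :=
  (expR p)%:C * w_max T uT M t x p.

Definition u_max_int T (uT : R -> R[i]) M t x p : R[i] :=
  (expR p)%:C * cintegral `[p, +oo[ (fun q => w_max T uT M t x q).

End defs.

(* Main.v *)
(* With h = fourier uT, which is square integrable and vanishes almost everywhere outside a
   segment, both versions of u_etamax(t, ., p) are the inverse transform of
   e^{eta^2 (T - t)} h 1_{|eta| <= etamax}: for p > etamax^2 T the absolute value in the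
   exponent is p + eta^2 (t - T) on |eta| <= etamax, so that w(t, x, q) = e^{p - q} w(t, x, p)
   for q >= p.  Hence u - u_etamax is the inverse transform of the part of
   e^{eta^2 (T - t)} h over |eta| > etamax, where e^{-eta^2 t} <= e^{-etamax^2 t} and
   etamax^{2 s} <= (1 + eta^2)^s.

   What has to be supplied is the inversion formula for such h: the L^2-Fourier transform of
   g(x) = \int e^{-i x eta} h(eta) d eta is h.  Let g_N be g restricted to [-N, N] and F_N the
   truncated transform of g.  Plancherel's identity for functions supported in a segment gives
   |F_N|^2 = |g_N|^2 / 2 pi, and Fubini gives <F_N, h> = |g_N|^2 / 2 pi, so that
   |F_N - h|^2 = |h|^2 - |g_N|^2 / 2 pi, which tends to 0 by Plancherel's identity for h.
   Plancherel's identity itself is obtained by Abel summation: weighting the squared transform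
   by e^{-e |t|} turns it into a quadratic form with the Poisson kernel, which is an
   approximate identity. *)
Require Import Defs.
From HB Require Import structures.
From mathcomp Require Import all_boot all_order all_algebra.
From mathcomp Require Import all_classical all_reals all_analysis.
From mathcomp Require Import complex.
From mathcomp Require Import measurable_realfun ring lra.

Set Implicit Arguments.
Unset Strict Implicit.
Unset Printing Implicit Defensive.

Import Order.TTheory GRing.Theory Num.Theory.
Import numFieldNormedType.Exports.

Local Open Scope classical_set_scope.
Local Open Scope ring_scope.

(** * Integrable functions against bounded kernels: domination, Fubini, continuity in a parameter *)

Section bounded_kernels.
Context d (T : measurableType d) (R : realType) (mu : {measure set T -> \bar R}).
Implicit Types (D : set T) (f g k : T -> R).

Lemma integrable_EFinD D f g : measurable D ->
  mu.-integrable D (EFin \o f) -> mu.-integrable D (EFin \o g) ->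
  mu.-integrable D (EFin \o (fun x => f x + g x)).
Proof. by move=> mD fi gi; exact: eq_integrable (integrableD mD fi gi). Qed.

Lemma integrable_EFinB D f g : measurable D ->
  mu.-integrable D (EFin \o f) -> mu.-integrable D (EFin \o g) ->
  mu.-integrable D (EFin \o (fun x => f x - g x)).
Proof. by move=> mD fi gi; exact: eq_integrable (integrableB mD fi gi). Qed.

Lemma integrable_EFinZl D f r : measurable D ->
  mu.-integrable D (EFin \o f) ->
  mu.-integrable D (EFin \o (fun x => r * f x)).
Proof. by move=> mD fi; exact: eq_integrable (integrableZl mD r fi). Qed.

Lemma integrable_EFinM_bounded D f k B : measurable D ->
  mu.-integrable D (EFin \o f) -> measurable_fun D k ->
  (forall x, D x -> `|k x| <= B) ->
  mu.-integrable D (EFin \o (fun x => f x * k x)).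
Proof.
move=> mD fi mk kB; apply: (@integrableMl _ _ _ mu D mD (EFin \o f) k) => //.
by exists B; split; [exact: num_real|move=> M BM x Dx /=; apply: le_trans (kB _ Dx) (ltW BM)].
Qed.

Lemma integrable_EFin_le D f g : measurable D -> measurable_fun D f ->
  mu.-integrable D (EFin \o g) -> (forall x, D x -> `|f x| <= g x) ->
  mu.-integrable D (EFin \o f).
Proof.
move=> mD mf gi fg; apply: le_integrable gi => //.
  exact/measurable_EFinP.
by move=> x Dx /=; rewrite lee_fin (le_trans (fg _ Dx))// ler_norm.
Qed.

Lemma EFin_Rintegral D f : measurable D -> mu.-integrable D (EFin \o f) ->
  (\int[mu]_(x in D) f x)%:E = (\int[mu]_(x in D) (f x)%:E)%E.
Proof. by move=> mD fi; rewrite fineK//; exact: integrable_fin_num. Qed.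

Lemma Rintegral_le_bound D f k B : measurable D ->
  mu.-integrable D (EFin \o f) -> measurable_fun D k ->
  (forall x, D x -> `|k x| <= B) ->
  `|\int[mu]_(x in D) (f x * k x)| <= \int[mu]_(x in D) `|f x| * B.
Proof.
move=> mD fi mk kB.
have fki := integrable_EFinM_bounded mD fi mk kB.
apply: le_trans (le_normr_Rintegral mD fki) _.
rewrite -RintegralZr//; last exact: integrable_norm.
apply: le_Rintegral => //.
- exact: integrable_norm.
- by apply: (@integrable_EFinM_bounded _ (fun x => `|f x|) (cst B) `|B|) => //; exact: integrable_norm.
- by move=> x Dx; rewrite normrM ler_wpM2l// kB.
Qed.

End bounded_kernels.

Section swap.
Context d1 d2 (T1 : measurableType d1) (T2 : measurableType d2) (R : realType).
Variables (m1 : {sigma_finite_measure set T1 -> \bar R}).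
Variables (m2 : {sigma_finite_measure set T2 -> \bar R}).

(** Fubini for a bounded kernel between two integrable weights. Absolute integrability on the
    product holds because the iterated integral of the absolute value is at most [B] times the
    product of the $L^1$ norms of the weights. *)
Lemma Rintegral_swap (D : set T1) (E : set T2) (f : T1 -> R) (g : T2 -> R)
    (k : T1 * T2 -> R) (B : R) :
  measurable D -> measurable E ->
  m1.-integrable D (EFin \o f) -> m2.-integrable E (EFin \o g) ->
  measurable_fun setT k -> (forall z, `|k z| <= B) ->
  \int[m1]_(x in D) (f x * \int[m2]_(y in E) (g y * k (x, y))) =
  \int[m2]_(y in E) (g y * \int[m1]_(x in D) (f x * k (x, y))).
Proof.
move=> mD mE fi gi mk kB.
(* Extension by zero turns the integrals over [D] and [E] into integrals over the whole spaces,
   where Fubini's theorem is applied. *)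
pose F := f \_ D; pose G := g \_ E.
have Fi : m1.-integrable setT (EFin \o F).
  by rewrite /F -restrict_EFin; apply/integrable_restrict => //; rewrite setTI.
have Gi : m2.-integrable setT (EFin \o G).
  by rewrite /G -restrict_EFin; apply/integrable_restrict => //; rewrite setTI.
have mF : measurable_fun setT F by case/integrableP : Fi => /measurable_EFinP.
have mG : measurable_fun setT G by case/integrableP : Gi => /measurable_EFinP.
have B0 : 0 <= B by rewrite (le_trans _ (kB point)).
have mk1 x : measurable_fun setT (fun y => k (x, y)) by exact: measurableT_comp.
have mk2 y : measurable_fun setT (fun x => k (x, y)) by exact: measurableT_comp.
pose H z : \bar R := (F z.1 * (G z.2 * k z))%:E.
have mH : measurable_fun setT H.
  apply/measurable_EFinP; apply: measurable_funM.
    exact: measurableT_comp mF measurable_fst.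
  by apply: measurable_funM => //; exact: measurableT_comp mG measurable_snd.
have GkI x : m2.-integrable setT (EFin \o (fun y => G y * k (x, y))).
  by apply: (@integrable_EFinM_bounded _ _ _ m2 setT G _ B).
have FkI y : m1.-integrable setT (EFin \o (fun x => F x * k (x, y))).
  by apply: (@integrable_EFinM_bounded _ _ _ m1 setT F _ B).
(* Tonelli's criterion: the inner integral of the absolute value is at most
   [|F x| * (B * \int |G|)], which is integrable in [x]. *)
have HI : (m1 \x m2)%E.-integrable setT H.
  apply/(integrable12ltyP m1 m2 mH).
  apply: (@le_lt_trans _ _ (\int[m1]_x (`|F x| * (B * \int[m2]_y `|G y|))%:E)%E).
    apply: ge0_le_integral => //.
    - by move=> x _; exact: integral_ge0.
    - apply: (measurable_fun_fubini_tonelli_F (abse \o H)) => //.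
        exact: measurableT_comp.
      by move=> z; exact: abse_ge0.
    - apply/measurable_EFinP; apply: measurable_funM => //.
      exact: measurableT_comp.
    - move=> x _; rewrite /H/=.
      have -> : (\int[m2]_y `|F x * (G y * k (x, y))|%:E)%E
              = (\int[m2]_y (`|F x|%:E * `|G y * k (x, y)|%:E))%E.
        by apply: eq_integral => y _; rewrite normrM EFinM.
      rewrite ge0_integralZl//; last first.
        apply/measurable_EFinP; apply: measurableT_comp => //.
        exact: measurable_funM.
      rewrite EFinM lee_pmul//; first exact: integral_ge0.
      rewrite EFinM EFin_Rintegral//; last exact: integrable_norm.
      rewrite -ge0_integralZl//; last first.
        by apply/measurable_EFinP; apply: measurableT_comp.
      apply: ge0_le_integral => //.
      + by apply/measurable_EFinP; apply: measurableT_comp => //; exact: measurable_funM.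
      + apply: measurable_funeM.
        by apply/measurable_EFinP; apply: measurableT_comp.
      + by move=> y _; rewrite -EFinM lee_fin normrM mulrC ler_wpM2r.
  under eq_integral do rewrite EFinM.
  rewrite ge0_integralZr//; last 2 first.
  - by apply/measurable_EFinP; apply: measurableT_comp.
  - by rewrite lee_fin mulr_ge0// Rintegral_ge0.
  rewrite -EFin_Rintegral//; last exact: integrable_norm.
  by rewrite -EFinM ltry.
have := Fubini HI.
have -> : (\int[m1]_x \int[m2]_y H (x, y) =
    \int[m1]_x (F x * \int[m2]_y (G y * k (x, y)))%:E)%E.
  apply: eq_integral => x _; rewrite /H/= EFinM EFin_Rintegral//.
  rewrite -integralZl//; last exact: GkI.
have -> : (\int[m2]_y \int[m1]_x H (x, y) =
    \int[m2]_y (G y * \int[m1]_x (F x * k (x, y)))%:E)%E.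
  apply: eq_integral => y _; rewrite /H/= EFinM EFin_Rintegral//.
  rewrite -integralZl//; last exact: FkI.
  by apply: eq_integral => x _; rewrite -EFinM mulrCA.
move=> /(congr1 fine); rewrite -!/(Rintegral _ _ _) => FE.
rewrite Rintegral_mkcond [RHS]Rintegral_mkcond.
transitivity (\int[m1]_x (F x * \int[m2]_y (G y * k (x, y)))).
  apply: eq_Rintegral => x _; rewrite /F !patchE; case: ifPn => _; last by rewrite mul0r.
  congr (_ * _); rewrite Rintegral_mkcond; apply: eq_Rintegral => y _.
  by rewrite /G !patchE; case: ifPn => _ //; rewrite mul0r.
rewrite [LHS]FE; apply: eq_Rintegral => y _; rewrite /G !patchE.
case: ifPn => _; last by rewrite mul0r.
congr (_ * _); rewrite [RHS]Rintegral_mkcond; apply: eq_Rintegral => x _.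
by rewrite /F !patchE; case: ifPn => _ //; rewrite mul0r.
Qed.

End swap.

Section continuity.
Context d (Y : measurableType d) (R : realType) (mu : {measure set Y -> \bar R}).

(** Continuity under the integral sign. The majorant [|f y| * B] does not depend on the parameter,
    so any window around [x] serves. *)
Lemma continuous_Rintegral_kernel (D : set Y) (f : Y -> R) (k : R -> Y -> R) B :
  measurable D -> mu.-integrable D (EFin \o f) ->
  (forall x, measurable_fun setT (k x)) -> (forall x y, `|k x y| <= B) ->
  (forall y, continuous (k ^~ y)) ->
  continuous (fun x => \int[mu]_(y in D) (f y * k x y)).
Proof.
move=> mD fi mk kB ck x.
apply: (@continuity_under_integral R _ Y mu (fun x y => f y * k x y) D mD
  (x - 1) (x + 1) _ _ (fun y => `|f y| * B)).
- move=> z _; apply: (@integrable_EFinM_bounded _ _ _ mu D f (k z) B) => //.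
  exact: measurable_funTS.
- apply: aeW => y Dy z _; apply: continuousM; first exact: cst_continuous.
  exact: ck.
- apply: (@integrable_EFinM_bounded _ _ _ mu D (fun y => `|f y|) (cst B) `|B|) => //.
  exact: integrable_norm.
- by move=> z _; apply: aeW => y Dy; rewrite normrM ler_wpM2l.
- by rewrite inE/= in_itv/= ltrBlDr !ltrDl ltr01.
Qed.

End continuity.

(** * The Poisson kernel *)

Section poisson_kernel.
Context {R : realType}.
Local Notation mu := (@lebesgue_measure R).
Implicit Types (e z x y t : R).

(** The Poisson kernel of the half-plane without the factor $1/\pi$: its total mass is [pi], whence
    the constants [pi] below. *)
Definition poisson e z := e / (e ^+ 2 + z ^+ 2).

Lemma poisson_ge0 e z : 0 < e -> 0 <= poisson e z.
Proof. by move=> e0; rewrite divr_ge0 ?(ltW e0)// addr_ge0 ?sqr_ge0. Qed.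

Let den_gt0 e z : 0 < e -> 0 < e ^+ 2 + z ^+ 2.
Proof. by move=> e0; rewrite ltr_wpDr ?sqr_ge0// exprn_gt0. Qed.

Lemma poisson_le e z : 0 < e -> poisson e z <= e^-1.
Proof.
move=> e0; rewrite /poisson ler_pdivrMr ?den_gt0// expr2 mulrDr mulKf ?gt_eqF//.
by rewrite lerDl mulr_ge0 ?sqr_ge0// invr_ge0 ltW.
Qed.

Lemma continuous_poisson e : 0 < e -> continuous (poisson e).
Proof.
move=> e0 z; apply: cvgM; first exact: cvg_cst.
apply: cvgV; first by rewrite gt_eqF// den_gt0.
by apply: cvgD; [exact: cvg_cst|exact: exprn_continuous].
Qed.

Lemma measurable_poisson e : 0 < e -> measurable_fun setT (poisson e).
Proof. by move=> e0; apply: continuous_measurable_fun; exact: continuous_poisson. Qed.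

(** The affine substitution [F y = e^-1 * (y - x)] reduces the integral to that of $1/(1+y^2)$,
    which is twice its value $\pi/2$ on the half-line. *)
Lemma integral_poisson e x : 0 < e ->
  (\int[mu]_y (poisson e (x - y))%:E = pi%:E)%E.
Proof.
move=> e0.
have -> : (pi%:E = \int[mu]_y ((@oneDsqr R y)^-1)%:E)%E.
  rewrite ge0_symfun_integralT//=.
  - rewrite -set_itvcy integral0y_oneDsqr -EFinM mulrCA divff ?mulr1//.
  - exact: continuous_oneDsqrV.
  - by move=> y; rewrite /= /oneDsqr sqrrN.
pose F y := e^-1 * (y - x).
have dF y : is_derive y 1 F e^-1.
  rewrite /F; apply: is_derive_eq.
  by rewrite subr0 /GRing.scale/= mulr1.
have F'E : derive1 F = cst e^-1 by apply/funext => y; rewrite derive1E derive_val.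
rewrite [RHS](@increasing_ge0_integration_by_substitutionT _ F) //.
- apply: eq_integral => y _; congr EFin; rewrite F'E /= fctE/= /poisson /F /oneDsqr.
  have h2 := den_gt0 (x - y) e0.
  have h1 : 0 < 1 + (e^-1 * (y - x)) ^+ 2 by rewrite ltr_wpDr ?sqr_ge0.
  have h3 := den_gt0 (y - x) e0.
  by field; rewrite !gt_eqF//=.
- by move=> a b ab; rewrite /F ltr_pM2l ?invr_gt0// ltrD2r.
- by rewrite F'E => ?; exact: cst_continuous.
- by rewrite F'E; exact: is_cvg_cst.
- by rewrite F'E; exact: is_cvg_cst.
- by apply: gt0_cvgMrNy; [rewrite invr_gt0|exact: cvg_addrr_Ny].
- by apply: gt0_cvgMry; [rewrite invr_gt0|exact: cvg_addrr].
- exact: continuous_oneDsqrV.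
Qed.

Lemma cvg_expRNM e : 0 < e -> expR (- (e * t)) @[t --> +oo%R] --> 0.
Proof.
move=> e0; apply: (cvg_comp (fun t => e * t) (fun t => expR (- t))).
  by apply: gt0_cvgMry => //; exact: cvg_id.
exact: cvgr_expR.
Qed.

Let is_derive_expRNM e t : is_derive t 1 (fun t : R => expR (- (e * t))) (- e * expR (- (e * t))).
Proof.
apply: is_derive_eq; rewrite /GRing.scale/= mulr1; ring.
Qed.

Let is_derive_cosM z t : is_derive t 1 (fun t : R => cos (z * t)) (- z * sin (z * t)).
Proof.
apply: is_derive_eq; rewrite /GRing.scale/= mulr1; ring.
Qed.

Let is_derive_sinM z t : is_derive t 1 (fun t : R => sin (z * t)) (z * cos (z * t)).
Proof.
apply: is_derive_eq; rewrite /GRing.scale/= mulr1; ring.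
Qed.

Lemma continuous_is_derive (F f : R -> R) : (forall t, is_derive t 1 F (f t)) -> continuous F.
Proof.
by move=> dF t; apply: differentiable_continuous; apply/derivable1_diffP; have [] := dF t.
Qed.

Lemma continuous_expRNM e : continuous (fun t : R => expR (- (e * t))).
Proof. by apply: continuous_is_derive => t; exact: is_derive_expRNM. Qed.

Lemma continuous_cosM z : continuous (fun t : R => cos (z * t)).
Proof. by apply: continuous_is_derive => t; exact: is_derive_cosM. Qed.

Lemma continuous_sinM z : continuous (fun t : R => sin (z * t)).
Proof. by apply: continuous_is_derive => t; exact: is_derive_sinM. Qed.

Lemma integral_expRN e : 0 < e ->
  (\int[mu]_(t in `[0%R, +oo[) (expR (- (e * t)))%:E = e^-1%:E)%E.
Proof.
move=> e0.
pose F t := - e^-1 * expR (- (e * t)).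
have dF t : is_derive t 1 F (expR (- (e * t))).
  rewrite /F; apply: is_derive_eq.
  by rewrite /GRing.scale/=; field; rewrite gt_eqF.
rewrite (@ge0_continuous_FTC2y _ _ F _ 0).
- by rewrite /F mulr0 oppr0 expR0 mulr1 sub0e EFinN oppeK.
- by move=> t _; exact: expR_ge0.
- by apply: continuous_subspaceT; exact: continuous_expRNM.
- rewrite /F -[X in _ --> X](mulr0 (- e^-1)); apply: cvgM; first exact: cvg_cst.
  exact: cvg_expRNM.
- by move=> t _; have [] := dF t.
- by apply: cvg_at_right_filter; exact: continuous_is_derive dF _.
- by move=> t _; rewrite derive1E derive_val.
Qed.

Lemma integrable_expRN e : 0 < e ->
  mu.-integrable `[0%R, +oo[ (EFin \o (fun t => expR (- (e * t)))).
Proof.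
move=> e0; apply/integrableP; split.
  apply/measurable_EFinP; apply: measurable_funTS.
  by apply: continuous_measurable_fun; exact: continuous_expRNM.
under eq_integral do rewrite /= ger0_norm ?expR_ge0//.
by rewrite integral_expRN// ltry.
Qed.

(** The cosine is shifted by 1 to make the integrand nonnegative, as the fundamental theorem of
    calculus on a half-line is used in its version for nonnegative functions. The shift is
    subtracted again in [Rintegral_expRN_cos]. *)
Let integral_expRN_1Dcos e z : 0 < e ->
  (\int[mu]_(t in `[0%R, +oo[) (expR (- (e * t)) * (1 + cos (z * t)))%:E
   = (e^-1 + poisson e z)%:E)%E.
Proof.
move=> e0; have D0 := den_gt0 z e0.
(* The first term is a primitive of the exponential, the second one of the exponential times the
   cosine, as found by integrating by parts twice. *)
pose F t := - e^-1 * expR (- (e * t)) +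
  (e ^+ 2 + z ^+ 2)^-1 * (expR (- (e * t)) * (z * sin (z * t) - e * cos (z * t))).
have dF t : is_derive t 1 F (expR (- (e * t)) * (1 + cos (z * t))).
  rewrite /F; apply: is_derive_eq.
  rewrite /GRing.scale/=; field.
  by rewrite !gt_eqF.
have cf : continuous (fun t : R => expR (- (e * t)) * (1 + cos (z * t))).
  move=> t; apply: cvgM; first exact: continuous_expRNM.
  by apply: cvgD; [exact: cvg_cst|exact: continuous_cosM].
rewrite (@ge0_continuous_FTC2y _ _ F _ 0).
- rewrite /F !mulr0 oppr0 expR0 sin0 cos0 mulr0 !mulr1 !mul1r sub0e -EFinN.
  by congr EFin; rewrite /poisson; field; rewrite !gt_eqF.
- by move=> t _; rewrite mulr_ge0 ?expR_ge0// -lerBlDl sub0r cos_geN1.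
- apply: continuous_subspaceT; exact: cf.
- have c0 := cvg_expRNM e0.
  rewrite /F -[X in _ --> X]addr0; apply: cvgD.
    rewrite -[X in _ --> X](mulr0 (- e^-1)).
    by apply: cvgM => //; exact: cvg_cst.
  rewrite -[X in _ --> X](mulr0 (e ^+ 2 + z ^+ 2)^-1); apply: cvgM; first exact: cvg_cst.
  (* The trigonometric factor is at most [|z| + e] in absolute value, so the exponential decay
     squeezes the product to 0. *)
  pose h t := expR (- (e * t)) * (`|z| + e).
  apply: (@squeeze_cvgr _ _ _ _ (fun t => - h t) h).
  + near=> t; rewrite -ler_norml normrM ger0_norm ?expR_ge0// ler_wpM2l ?expR_ge0//.
    rewrite (le_trans (ler_normB _ _))// !normrM lerD//.
      by rewrite ler_piMr// ler_norml sin_geN1 sin_le1.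
    by rewrite (gtr0_norm e0) ler_piMr ?(ltW e0)// ler_norml cos_geN1 cos_le1.
  + rewrite -[X in _ --> X]oppr0; apply: cvgN.
    by rewrite -[X in _ --> X](mul0r (`|z| + e)); apply: cvgM => //; exact: cvg_cst.
  + by rewrite -[X in _ --> X](mul0r (`|z| + e)); apply: cvgM => //; exact: cvg_cst.
- by move=> t _; have [] := dF t.
- by apply: cvg_at_right_filter; exact: continuous_is_derive dF _.
- by move=> t _; rewrite derive1E derive_val.
Unshelve. all: by end_near. Qed.

(** The Laplace transform of the cosine: this is how Abel weights produce the Poisson kernel. *)
Lemma Rintegral_expRN_cos e z : 0 < e ->
  \int[mu]_(t in `[0%R, +oo[) (expR (- (e * t)) * cos (z * t)) = poisson e z.
Proof.
move=> e0.
have i1 := integrable_expRN e0.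
have mc : measurable_fun (`[0%R, +oo[ : set R) (fun t => cos (z * t)).
  apply: measurable_funTS.
  by apply: continuous_measurable_fun; exact: continuous_cosM.
have i2 : mu.-integrable `[0%R, +oo[ (EFin \o (fun t => expR (- (e * t)) * cos (z * t))).
  apply: (@integrable_EFinM_bounded _ _ _ mu _ _ _ 1) => // t _.
  by rewrite ler_norml cos_geN1 cos_le1.
have := congr1 fine (integral_expRN_1Dcos z e0) => /=; rewrite -/(Rintegral _ _ _).
under eq_Rintegral do rewrite mulrDr mulr1.
rewrite RintegralD//.
by rewrite {1}/Rintegral integral_expRN//= => /addrI.
Qed.

(** * The Poisson kernel as an approximate identity at a point of continuity *)

Section approximate_identity.
Variables (phi : R -> R) (M x : R).
Hypotheses (mphi : measurable_fun setT phi) (phiM : forall y, `|phi y| <= M).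
Hypothesis cphi : {for x, continuous phi}.

Lemma integrable_poisson e : 0 < e ->
  mu.-integrable setT (EFin \o (fun y => poisson e (x - y))).
Proof.
move=> e0; apply/integrableP; split.
  apply/measurable_EFinP.
  apply: measurableT_comp; first exact: measurable_poisson.
  exact: measurable_funB.
under eq_integral do rewrite /= ger0_norm ?poisson_ge0//.
by rewrite integral_poisson// ltry.
Qed.

Lemma Rintegral_poisson e : 0 < e -> \int[mu]_y poisson e (x - y) = pi.
Proof. by move=> e0; rewrite /Rintegral integral_poisson. Qed.

(* far from x, [poisson e] is bounded by a multiple of [e * poisson 1] *)
Lemma cvg_poisson :
  \int[mu]_y (poisson n.+1%:R^-1 (x - y) * phi y) @[n --> \oo] --> pi * phi x.
Proof.
apply/cvgrPdist_le => tau tau0.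
have M0 : 0 <= M by exact: le_trans (phiM 0).
(* The kernel has mass [pi], so an oscillation of at most [t2] near [x] contributes at most
   [tau / 2]. *)
pose t2 := tau / 2 / pi.
have t20 : 0 < t2 by rewrite !divr_gt0// pi_gt0.
have /cvgrPdist_le /(_ _ t20) [d /= d0 near_x] := cphi.
have d2 : 0 <= d^-2 by rewrite invr_ge0 exprn_ge0// ltW.
have d21 : 0 <= 1 + d^-2 by rewrite addr_ge0.
(* The constant of the far part: [phi] varies by at most [2 * M], the kernel is at most
   [(1 + d^-2) * e * poisson 1] at distance at least [d], and [poisson 1] has mass [pi]. *)
pose A := 2 * M * (1 + d^-2) * pi.
have pie (e : R) : 0 < e ->
    `|pi * phi x - \int[mu]_y (poisson e (x - y) * phi y)| <= tau / 2 + A * e.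
  move=> e0.
  have ip := integrable_poisson e0; have ip1 := integrable_poisson (@ltr01 R).
  have ipp : mu.-integrable setT (EFin \o (fun y => poisson e (x - y) * phi y)).
    exact: (@integrable_EFinM_bounded _ _ _ mu _ _ _ M).
  have -> : pi * phi x = \int[mu]_y (poisson e (x - y) * phi x).
    by rewrite RintegralZr// Rintegral_poisson.
  have ipx : mu.-integrable setT (EFin \o (fun y => poisson e (x - y) * phi x)).
    apply: (@integrable_EFinM_bounded _ _ _ mu _ _ (cst (phi x)) M) => // y _.
    exact: phiM.
  rewrite -RintegralB//.
  apply: le_trans (le_normr_Rintegral _ _) _ => //; first exact: integrable_EFinB.
  have -> : tau / 2 + A * e = \int[mu]_y (t2 * poisson e (x - y) +
      (2 * M * (1 + d^-2) * e) * poisson 1 (x - y)).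
    rewrite RintegralD//; [|exact: integrable_EFinZl..].
    rewrite (RintegralZl _ measurableT ip) (RintegralZl _ measurableT ip1).
    rewrite !Rintegral_poisson//.
    rewrite /t2 /A; have : pi != 0 :> R by rewrite gt_eqF ?pi_gt0.
    by move: (pi : R) => q q0; field; rewrite q0 gt_eqF.
  apply: le_Rintegral => //.
  - by apply: integrable_norm; exact: integrable_EFinB.
  - by apply: integrable_EFinD => //; exact: integrable_EFinZl.
  move=> y _; rewrite -mulrBr normrM (ger0_norm (poisson_ge0 _ e0)).
  have [yx|yx] := ltP `|x - y| d.
    rewrite mulrC -[leLHS]addr0 lerD//.
      by rewrite ler_wpM2r ?poisson_ge0//; exact: near_x.
    apply: mulr_ge0; last exact: poisson_ge0.
    by rewrite !mulr_ge0// ltW.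
  rewrite -[leLHS]add0r lerD//; first by apply: mulr_ge0 (ltW t20) (poisson_ge0 _ e0).
  have -> : 2 * M * (1 + d^-2) * e * poisson 1 (x - y) =
    ((1 + d^-2) * e * poisson 1 (x - y)) * (2 * M) by ring.
  rewrite ler_pM ?poisson_ge0//; last first.
    by rewrite (le_trans (ler_normB _ _))// mulr_natl mulr2n lerD.
  rewrite /poisson expr1n [leRHS](_ : _ = e * ((1 + d^-2) / (1 + (x - y) ^+ 2))); last by ring.
  rewrite ler_pM2l// -(div1r (_ + _)) ler_pdivrMr ?den_gt0// mulrAC ler_pdivlMr ?mul1r; last first.
    by rewrite ltr_wpDr ?sqr_ge0.
  have dx : d ^+ 2 <= (x - y) ^+ 2 by rewrite -[leRHS]real_normK ?num_real// ler_sqr ?nnegrE ?(ltW d0).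
  (* With $z = x - y$ and $|z| \ge d$ this gives $1 + z^2 \le (1 + d^{-2}) z^2 \le (1 + d^{-2})(e^2
     + z^2)$, which is the comparison of the two kernels after clearing denominators. *)
  have : 1 <= d^-2 * (x - y) ^+ 2 by rewrite mulrC ler_pdivlMr ?mul1r// exprn_gt0.
  move: d2.
  have : 0 <= e ^+ 2 by rewrite sqr_ge0.
  move: (e ^+ 2) ((x - y) ^+ 2) (d^-2) => a b c; nra.
have A0 : 0 <= A.
  by rewrite !mulr_ge0 ?pi_ge0.
near=> n.
have n0 : 0 < n.+1%:R^-1 :> R by rewrite invr_gt0.
apply: le_trans (pie _ n0) _.
rewrite [leRHS](splitr tau) lerD2l.
rewrite (@le_trans _ _ ((A + 1) * n.+1%:R^-1))// ?ler_wpM2r ?lerDl//.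
rewrite ler_pdivrMr// -ler_pdivrMl ?divr_gt0//.
rewrite (le_trans (ltW (archi_boundP _)))//.
  by rewrite mulr_ge0 ?invr_ge0 ?addr_ge0// ltW// divr_gt0.
rewrite ler_nat ltnW// ltnS; near: n; exact: nbhs_infty_ge.
Unshelve. all: by end_near. Qed.

End approximate_identity.
End poisson_kernel.

(** * Square-integrable functions on a set of finite measure *)

Lemma sqrB_triangle (R : realDomainType) (p q r : R) :
  (p - r) ^+ 2 <= 2 * (p - q) ^+ 2 + 2 * (q - r) ^+ 2.
Proof. by have := sqr_ge0 ((p - q) - (q - r)); lra. Qed.

Section dominated.
Context d (T : measurableType d) (R : realType) (mu : {measure set T -> \bar R}).

Lemma ae_imply (P Q : T -> Prop) : (forall x, P x -> Q x) ->
  {ae mu, forall x, P x} -> {ae mu, forall x, Q x}.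
Proof. by move=> PQ; apply: filterS. Qed.

Lemma ae_imply2 (P Q S : T -> Prop) : (forall x, P x -> Q x -> S x) ->
  {ae mu, forall x, P x} -> {ae mu, forall x, Q x} -> {ae mu, forall x, S x}.
Proof. by move=> PQ; apply: filterS2. Qed.

Lemma Rintegral_dominated_cvg (D : set T) (f_ : nat -> T -> R) (f g : T -> R) :
  measurable D -> (forall n, measurable_fun D (f_ n)) -> measurable_fun D f ->
  {ae mu, forall x, D x -> f_ n x @[n --> \oo] --> f x} ->
  mu.-integrable D (EFin \o g) ->
  (forall n x, D x -> `|f_ n x| <= g x) ->
  \int[mu]_(x in D) f_ n x @[n --> \oo] --> \int[mu]_(x in D) f x.
Proof.
move=> mD mf_ mf cf gi fg.
have [] := @dominated_convergence _ _ _ mu D mD (fun n => EFin \o f_ n) (EFin \o f) (EFin \o g).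
- by move=> n; exact/measurable_EFinP.
- exact/measurable_EFinP.
- by apply: filterS cf => x h Dx; apply: cvg_EFin; [exact: nearW|exact: h].
- exact: gi.
- by apply: aeW => x n Dx /=; rewrite lee_fin fg.
move=> fi _ h; apply: fine_cvg; rewrite fineK//.
exact: integrable_fin_num.
Qed.

End dominated.

(** * Cutting off values at a level *)

Section clamp.
Context {R : realType}.
Implicit Types M x y : R.

Definition clamp M x := Num.max (- M) (Num.min M x).

Lemma clamp_le M x : 0 <= M -> `|clamp M x| <= M.
Proof.
move=> M0; rewrite /clamp maxEle minEle ler_norml.
by case: ifP; case: ifP => *; lra.
Qed.

Lemma clamp_id M x : `|x| <= M -> clamp M x = x.
Proof.
rewrite ler_norml => /andP[h1 h2]; rewrite /clamp minEle maxEle.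
by case: (leP M x) => *; case: ifPn; rewrite -?ltNge => *; lra.
Qed.

Lemma clamp_lipschitz M x y : 0 <= M -> `|clamp M x - clamp M y| <= `|x - y|.
Proof.
move=> M0.
wlog xy : x y / y <= x.
  by move=> h; have [/ltW/h|/h//] := ltP x y; rewrite distrC (distrC y).
have xy0 : 0 <= x - y by rewrite subr_ge0.
rewrite /clamp !minEle !maxEle (ger0_norm xy0) ler_norml {xy0}.
by case: (boolP (M <= x)) => h1; case: (boolP (M <= y)) => h2;
  move: h1 h2; rewrite /= -?ltNge => h1 h2; do ?case: ifPn; rewrite -?ltNge => *;
  apply/andP; split; lra.
Qed.

Lemma sqr_subr_clamp_le M x : 0 <= M -> (x - clamp M x) ^+ 2 <= x ^+ 2.
Proof.
move=> M0; rewrite /clamp minEle maxEle.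
by case: (leP M x) => ?; case: ifPn; rewrite -?ltNge => ?; nra.
Qed.

Lemma continuous_clamp M : continuous (clamp M).
Proof.
move=> x; rewrite /clamp; apply: (@continuous_max _ _ (cst (- M)) (fun x => Num.min M x)).
  exact: cvg_cst.
by apply: (@continuous_min _ _ (cst M) (fun x => x)); [exact: cvg_cst|exact: cvg_id].
Qed.

End clamp.

Section square_integrable.
Context {R : realType}.
Local Notation mu := (@lebesgue_measure R).
Variables (D : set R).
Hypotheses (mD : measurable D) (Dfin : (mu D < +oo)%E).
Implicit Types (a b c : R -> R).

Definition sqint a := measurable_fun D a /\
  mu.-integrable D (EFin \o (fun x => a x ^+ 2)).

Lemma integrable_EFin_cst (k : R) : mu.-integrable D (EFin \o cst k).
Proof.
apply: measurable_bounded_integrable => //; exists `|k|; split => //.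
by move=> M kM x Dx; exact: ltW.
Qed.

Lemma bounded_sqint a M : measurable_fun D a -> (forall x, D x -> `|a x| <= M) ->
  sqint a.
Proof.
move=> ma aM; split=> //.
apply: (@integrable_EFin_le _ _ _ mu D _ (cst (M ^+ 2))) => //.
- exact: measurable_funX.
- exact: integrable_EFin_cst.
- move=> x Dx /=; rewrite normrX ler_sqr ?nnegrE//; first exact: aM.
  exact: le_trans (aM _ Dx).
Qed.

(** The bound $|a| \le 1 + a^2$ suffices because [D] has finite measure. *)
Lemma sqint_integrable a : sqint a -> mu.-integrable D (EFin \o a).
Proof.
move=> [ma ia]; apply: (@integrable_EFin_le _ _ _ mu D _ (fun x => 1 + a x ^+ 2)) => //.
  apply: integrable_EFinD => //.
  exact: integrable_EFin_cst.
by move=> x Dx; rewrite ler_norml; apply/andP; split; nra.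
Qed.

Lemma sqintB a b : sqint a -> sqint b -> sqint (fun x => a x - b x).
Proof.
move=> [ma ia] [mb ib]; split; first exact: measurable_funB.
apply: (@integrable_EFin_le _ _ _ mu D _ (fun x => 2 * a x ^+ 2 + 2 * b x ^+ 2)) => //.
- by apply: measurable_funX; exact: measurable_funB.
- by apply: integrable_EFinD => //; exact: integrable_EFinZl.
- move=> x Dx; rewrite ger0_norm ?sqr_ge0//.
  by have := sqr_ge0 (a x + b x); move: (a x) (b x) => p q; lra.
Qed.

Lemma sqintM_integrable a b : sqint a -> sqint b ->
  mu.-integrable D (EFin \o (fun x => a x * b x)).
Proof.
move=> [ma ia] [mb ib].
apply: (@integrable_EFin_le _ _ _ mu D _ (fun x => a x ^+ 2 + b x ^+ 2)) => //.
- exact: measurable_funM.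
- exact: integrable_EFinD.
- move=> x Dx; move: (a x) (b x) => p q.
  have h1 := sqr_ge0 (p + q); have h2 := sqr_ge0 (p - q).
  by rewrite ler_norml; apply/andP; split; nra.
Qed.

(** Dominated convergence with majorant [a x ^+ 2]: at each point the difference vanishes as soon as
    [n] exceeds [|a x|]. *)
Lemma sqint_clamp_approx a tau : sqint a -> 0 < tau -> exists n : nat,
  \int[mu]_(x in D) (a x - clamp n%:R (a x)) ^+ 2 <= tau.
Proof.
move=> [ma ia] tau0.
have := @Rintegral_dominated_cvg _ _ _ mu D
  (fun n x => (a x - clamp n%:R (a x)) ^+ 2) (cst 0) (fun x => a x ^+ 2) mD.
have -> : \int[mu]_(x in D) cst 0 x = 0 by rewrite Rintegral_cst// mul0r.
move=> /(_ _ _ _ ia _) H.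
suff /cvgrPdist_le/(_ _ tau0)[N _ /(_ N) /=] :
    \int[mu]_(x in D) (a x - clamp n%:R (a x)) ^+ 2 @[n --> \oo] --> (0 : R).
  rewrite sub0r normrN => /(_ (leqnn N)) h; exists N; apply: le_trans h.
  exact: ler_norm.
apply: H => //.
- move=> n; apply: measurable_funX; apply: measurable_funB => //.
  apply: measurableT_comp ma; apply: continuous_measurable_fun; exact: continuous_clamp.
- apply: aeW => x Dx; apply: cvg_near_cst; near=> n; apply/eqP.
  rewrite clamp_id ?subrr ?expr0n//.
  apply: le_trans (ltW (archi_boundP _)) _ => //.
  by rewrite ler_nat; near: n; exact: nbhs_infty_ge.
- move=> n x Dx; rewrite ger0_norm ?sqr_ge0//; exact: sqr_subr_clamp_le.
Unshelve. all: by end_near. Qed.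

(** Density of continuous functions in $L^2$, derived from their density in $L^1$. The function is
    first cut off at a level [n], then approximated in $L^1$; cutting off the approximant at the
    same level makes both functions bounded, and for these a small $L^1$ distance forces a small
    $L^2$ distance. *)
Lemma sqint_continuous_approx a tau : sqint a -> 0 < tau ->
  exists c M, [/\ continuous c, forall x, `|c x| <= M &
    \int[mu]_(x in D) (a x - c x) ^+ 2 <= tau].
Proof.
move=> sa tau0; have [ma ia] := sa.
have [n an] := sqint_clamp_approx sa (divr_gt0 tau0 (ltr0Sn R 3)).
pose b x := clamp n%:R (a x).
have mb : measurable_fun D b.
  apply: measurableT_comp ma; apply: continuous_measurable_fun; exact: continuous_clamp.
have sb : sqint b.
  by apply: (@bounded_sqint _ n%:R) => // x _; exact: clamp_le.
have [g [cg ig]] := approximation_continuous_integrable mD Dfin (sqint_integrable sb).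
(* Chosen so that [4 * n * eps <= tau / 2]; the successor keeps the denominator nonzero for [n = 0].
   The other [tau / 2] is twice the error [tau / 4] of the first cut-off. *)
pose eps := tau / (8 * n.+1%:R).
have eps0 : 0 < eps by rewrite divr_gt0// mulr_gt0.
move=> /fine_cvgP[_ /cvgrPdist_le/(_ _ eps0)[k _ /(_ k (leqnn k)) /=]].
rewrite sub0r normrN -/(Rintegral mu D (fun z => `|b z - g k z|)) ger0_norm; last first.
  by apply: Rintegral_ge0.
move=> gk.
pose c x := clamp n%:R (g k x).
have cc : continuous c.
  move=> x; exact: (@continuous_comp _ _ _ (g k) (clamp n%:R) x (cg k x)
    (@continuous_clamp _ _ _)).
have mc : measurable_fun setT c by exact: continuous_measurable_fun.
have cn x : `|c x| <= n%:R by exact: clamp_le.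
exists c, n%:R; split => //.
have sc : sqint c by apply: (@bounded_sqint _ n%:R) => //; exact: measurable_funTS.
have [_ iac] := sqintB sa sc.
have [_ iab] := sqintB sa sb.
have ibg : mu.-integrable D (EFin \o (fun x => `|b x - g k x|)).
  have igk : mu.-integrable D (EFin \o g k) by have := ig k.
  apply: integrable_norm.
  have ib := sqint_integrable sb.
  have h := @integrable_EFinB _ _ _ mu D b (g k) mD ib igk.
  exact: h.
apply: (@le_trans _ _ (\int[mu]_(x in D)
    (2 * (a x - b x) ^+ 2 + (4 * n%:R) * `|b x - g k x|))).
  apply: le_Rintegral => //.
    by apply: integrable_EFinD => //; exact: integrable_EFinZl.
  move=> x Dx.
  (* One factor of the square is bounded by the two levels; the other by the Lipschitz property of
     [clamp], which fixes [b x]. *)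
  have bc : (b x - c x) ^+ 2 <= 2 * n%:R * `|b x - g k x|.
    have h1 : `|b x - c x| <= `|b x - g k x|.
      rewrite /c -[X in `|X - _|](@clamp_id _ n%:R); last exact: clamp_le.
      exact: clamp_lipschitz.
    have h2 : `|b x - c x| <= 2 * n%:R.
      by rewrite (le_trans (ler_normB _ _))// mulr_natl mulr2n lerD// clamp_le.
    by rewrite -real_normK ?num_real// expr2 ler_pM.
  have : (a x - c x) ^+ 2 <= 2 * (a x - b x) ^+ 2 + 2 * (b x - c x) ^+ 2.
    exact: sqrB_triangle.
  move: bc; move: (_ ^+ 2) (_ ^+ 2) (_ ^+ 2) (`|_|) => p q r s; nra.
rewrite RintegralD//; [|exact: integrable_EFinZl..].
rewrite RintegralZl// RintegralZl//.
have h3 : 4 * n%:R * eps <= tau / 2.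
  rewrite /eps mulrA ler_pdivrMr ?mulr_gt0//.
  have -> : tau / 2 * (8 * n.+1%:R) = 4 * tau * n.+1%:R by field.
  by rewrite mulrAC ler_pM2l ?mulr_gt0// ler_nat.
have : 4 * n%:R * \int[mu]_(x in D) `|b x - g k x| <= 4 * n%:R * eps.
  by rewrite ler_wpM2l// mulr_ge0.
move: an; rewrite -/(Rintegral mu D (fun x => (a x - b x) ^+ 2)).
move: (\int[mu]_(x in D) _) (4 * n%:R * _) (4 * n%:R * eps) h3 => p q r; lra.
Qed.

End square_integrable.

(** * Cosine and sine transforms, and Abel summation *)

Section cosine_sine_transforms.
Context {R : realType}.
Local Notation mu := (@lebesgue_measure R).
Implicit Types (D : set R) (a b : R -> R) (e x y t : R).

Definition cosT D a t := \int[mu]_(y in D) (a y * cos (t * y)).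
Definition sinT D a t := \int[mu]_(y in D) (a y * sin (t * y)).

Lemma cos_norm_le1 x : `|cos x| <= 1.
Proof. by rewrite ler_norml cos_geN1 cos_le1. Qed.

Lemma sin_norm_le1 x : `|sin x| <= 1.
Proof. by rewrite ler_norml sin_geN1 sin_le1. Qed.

Lemma measurable_cosM t : measurable_fun setT (fun y : R => cos (t * y)).
Proof. by apply: continuous_measurable_fun; exact: continuous_cosM. Qed.

Lemma measurable_sinM t : measurable_fun setT (fun y : R => sin (t * y)).
Proof. by apply: continuous_measurable_fun; exact: continuous_sinM. Qed.

Section transform.
Variables (D : set R) (mD : measurable D).

Lemma integrable_Mcos a t : mu.-integrable D (EFin \o a) ->
  mu.-integrable D (EFin \o (fun y => a y * cos (t * y))).
Proof.
move=> ia; apply: (@integrable_EFinM_bounded _ _ _ mu D a _ 1) => //.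
  by apply: measurable_funTS; exact: measurable_cosM.
by move=> x _; exact: cos_norm_le1.
Qed.

Lemma integrable_Msin a t : mu.-integrable D (EFin \o a) ->
  mu.-integrable D (EFin \o (fun y => a y * sin (t * y))).
Proof.
move=> ia; apply: (@integrable_EFinM_bounded _ _ _ mu D a _ 1) => //.
  by apply: measurable_funTS; exact: measurable_sinM.
by move=> x _; exact: sin_norm_le1.
Qed.

Lemma continuous_cosT a : mu.-integrable D (EFin \o a) -> continuous (cosT D a).
Proof.
move=> ia; apply: (@continuous_Rintegral_kernel _ _ _ mu D a (fun t y => cos (t * y)) 1) => //.
- exact: measurable_cosM.
- by move=> x y; exact: cos_norm_le1.
- move=> y t; have -> : (fun z : R => cos (z * y)) = (fun z => cos (y * z)).
    by apply/funext => z; rewrite mulrC.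
  exact: continuous_cosM.
Qed.

Lemma continuous_sinT a : mu.-integrable D (EFin \o a) -> continuous (sinT D a).
Proof.
move=> ia; apply: (@continuous_Rintegral_kernel _ _ _ mu D a (fun t y => sin (t * y)) 1) => //.
- exact: measurable_sinM.
- by move=> x y; exact: sin_norm_le1.
- move=> y t; have -> : (fun z : R => sin (z * y)) = (fun z => sin (y * z)).
    by apply/funext => z; rewrite mulrC.
  exact: continuous_sinM.
Qed.

Lemma cosT_le a t : mu.-integrable D (EFin \o a) ->
  `|cosT D a t| <= \int[mu]_(y in D) `|a y|.
Proof.
move=> ia; rewrite -[leRHS]mulr1; apply: Rintegral_le_bound => //.
  by apply: measurable_funTS; exact: measurable_cosM.
by move=> x _; exact: cos_norm_le1.
Qed.

Lemma sinT_le a t : mu.-integrable D (EFin \o a) ->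
  `|sinT D a t| <= \int[mu]_(y in D) `|a y|.
Proof.
move=> ia; rewrite -[leRHS]mulr1; apply: Rintegral_le_bound => //.
  by apply: measurable_funTS; exact: measurable_sinM.
by move=> x _; exact: sin_norm_le1.
Qed.

Lemma measurable_cosT a : mu.-integrable D (EFin \o a) -> measurable_fun setT (cosT D a).
Proof. by move=> ia; apply: continuous_measurable_fun; exact: continuous_cosT. Qed.

Lemma measurable_sinT a : mu.-integrable D (EFin \o a) -> measurable_fun setT (sinT D a).
Proof. by move=> ia; apply: continuous_measurable_fun; exact: continuous_sinT. Qed.

Lemma cosTD a b t : mu.-integrable D (EFin \o a) -> mu.-integrable D (EFin \o b) ->
  cosT D (fun x => a x + b x) t = cosT D a t + cosT D b t.
Proof.
move=> ia ib; rewrite /cosT -RintegralD//; [|exact: integrable_Mcos..].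
by apply: eq_Rintegral => x _; rewrite mulrDl.
Qed.

Lemma sinTD a b t : mu.-integrable D (EFin \o a) -> mu.-integrable D (EFin \o b) ->
  sinT D (fun x => a x + b x) t = sinT D a t + sinT D b t.
Proof.
move=> ia ib; rewrite /sinT -RintegralD//; [|exact: integrable_Msin..].
by apply: eq_Rintegral => x _; rewrite mulrDl.
Qed.

Lemma cosTB a b t : mu.-integrable D (EFin \o a) -> mu.-integrable D (EFin \o b) ->
  cosT D (fun x => a x - b x) t = cosT D a t - cosT D b t.
Proof.
move=> ia ib; rewrite /cosT -RintegralB//; [|exact: integrable_Mcos..].
by apply: eq_Rintegral => x _; rewrite mulrBl.
Qed.

Lemma sinTB a b t : mu.-integrable D (EFin \o a) -> mu.-integrable D (EFin \o b) ->
  sinT D (fun x => a x - b x) t = sinT D a t - sinT D b t.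
Proof.
move=> ia ib; rewrite /sinT -RintegralB//; [|exact: integrable_Msin..].
by apply: eq_Rintegral => x _; rewrite mulrBl.
Qed.

(** The Abel mean of the squared modulus of the transform of a real function. This modulus is even
    in [t], so the half-line carries all the information. *)
Definition abel e a :=
  \int[mu]_(t in `[0%R, +oo[) (expR (- (e * t)) * (cosT D a t ^+ 2 + sinT D a t ^+ 2)).

(** The squared modulus of the transform is the double integral of $a(x) a(y) \cos((x - y) t)$.
    Integrating in [t] first, by two applications of Fubini, leaves the Laplace transform of the
    cosine. *)
Lemma abel_poisson e a : 0 < e -> mu.-integrable D (EFin \o a) ->
  abel e a = \int[mu]_(x in D) (a x * \int[mu]_(y in D) (a y * poisson e (x - y))).
Proof.
move=> e0 ia; pose A := \int[mu]_(y in D) `|a y|.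
have ie := integrable_expRN e0.
have cA t : `|cosT D a t| <= A by exact: cosT_le.
have sA t : `|sinT D a t| <= A by exact: sinT_le.
(* Only the integral in [x] is opened at first. The one in [y] stays inside [k], which is bounded by
   [A + A], so that the first exchange is between [t] and [x] alone. *)
pose k (z : R * R) := cos (z.1 * z.2) * cosT D a z.1 + sin (z.1 * z.2) * sinT D a z.1.
have mk : measurable_fun setT k.
  apply: measurable_funD; apply: measurable_funM.
  - apply: measurableT_comp; last exact: measurable_funM.
    by apply: continuous_measurable_fun; exact: continuous_cos.
  - by apply: measurableT_comp => //; exact: measurable_cosT.
  - apply: measurableT_comp; last exact: measurable_funM.
    by apply: continuous_measurable_fun; exact: continuous_sin.
  - by apply: measurableT_comp => //; exact: measurable_sinT.
have kA z : `|k z| <= A + A.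
  rewrite (le_trans (ler_normD _ _))// !normrM -[X in _ <= X + _]mul1r -[X in _ <= _ + X]mul1r.
  by rewrite lerD// ler_pM// ?cos_norm_le1 ?sin_norm_le1.
have kE t x : k (t, x) = \int[mu]_(y in D) (a y * cos ((x - y) * t)).
  rewrite /k /= -RintegralZl//; last exact: integrable_Mcos.
  rewrite -RintegralZl//; last exact: integrable_Msin.
  rewrite -RintegralD//.
  - apply: eq_Rintegral => y _; rewrite mulrBl cosB (mulrC x) (mulrC y); ring.
  - by apply: integrable_EFinZl => //; exact: integrable_Mcos.
  - by apply: integrable_EFinZl => //; exact: integrable_Msin.
transitivity (\int[mu]_(t in `[0%R, +oo[)
    (expR (- (e * t)) * \int[mu]_(x in D) (a x * k (t, x)))).
  apply: eq_Rintegral => t _; congr (_ * _).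
  set cc := cosT D a t; set ss := sinT D a t.
  have icos := integrable_Mcos t ia; have isin := integrable_Msin t ia.
  have -> : cc ^+ 2 = \int[mu]_(x in D) (a x * cos (t * x) * cc).
    by rewrite RintegralZr.
  have -> : ss ^+ 2 = \int[mu]_(x in D) (a x * sin (t * x) * ss).
    by rewrite RintegralZr.
  rewrite -RintegralD//.
  - by apply: eq_Rintegral => y _; rewrite /k/= -/cc -/ss; ring.
  - have := @integrable_EFinZl _ _ _ mu D _ cc mD icos.
    by apply: eq_integrable => // y _ /=; rewrite mulrC.
  - have := @integrable_EFinZl _ _ _ mu D _ ss mD isin.
    by apply: eq_integrable => // y _ /=; rewrite mulrC.
have mI : measurable (`[0%R, +oo[ : set R) by [].
have -> := @Rintegral_swap _ _ _ _ R mu mu _ D _ a k (A + A) mI mD ie ia mk kA.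
apply: eq_Rintegral => x _; congr (_ * _).
under eq_Rintegral do rewrite kE.
have mk2 : measurable_fun setT (fun z : R * R => cos ((x - z.2) * z.1)).
  apply: measurableT_comp; first by apply: continuous_measurable_fun; exact: continuous_cos.
  by apply: measurable_funM => //; exact: measurable_funB.
have k21 (z : R * R) : `|cos ((x - z.2) * z.1)| <= 1 by exact: cos_norm_le1.
(* The second exchange, between [t] and [y] for fixed [x]. *)
have -> := @Rintegral_swap _ _ _ _ R mu mu _ D _ a _ 1 mI mD ie ia mk2 k21.
by apply: eq_Rintegral => y _; rewrite /= Rintegral_expRN_cos.
Qed.

Lemma integrable_abel e a : 0 < e -> mu.-integrable D (EFin \o a) ->
  mu.-integrable `[0%R, +oo[ (EFin \o
    (fun t => expR (- (e * t)) * (cosT D a t ^+ 2 + sinT D a t ^+ 2))).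
Proof.
move=> e0 ia; pose A := \int[mu]_(y in D) `|a y|.
have ie := integrable_expRN e0.
apply: (@integrable_EFinM_bounded _ _ _ mu _ _ _ (A ^+ 2 + A ^+ 2)) => //.
  apply: measurable_funTS; apply: measurable_funD; apply: measurable_funX.
    exact: measurable_cosT.
  exact: measurable_sinT.
move=> t _; rewrite ger0_norm ?addr_ge0 ?sqr_ge0// -(real_normK (num_real (cosT _ _ _))).
rewrite -(real_normK (num_real (sinT _ _ _))) lerD// ler_sqr ?nnegrE ?cosT_le ?sinT_le//.
  by apply: Rintegral_ge0.
by apply: Rintegral_ge0.
Qed.

Lemma abel_ge0 e a : 0 <= abel e a.
Proof.
by apply: Rintegral_ge0 => t _; rewrite mulr_ge0 ?expR_ge0// addr_ge0 ?sqr_ge0.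
Qed.

(** The transforms are linear, so the parallelogram law holds for each [t] under the integral. *)
Lemma abel_parallelogram e a b : 0 < e ->
  mu.-integrable D (EFin \o a) -> mu.-integrable D (EFin \o b) ->
  abel e (fun x => a x + b x) + abel e (fun x => a x - b x) = 2 * abel e a + 2 * abel e b.
Proof.
move=> e0 ia ib.
have iD := @integrable_EFinD _ _ _ mu D a b mD ia ib.
have iB := @integrable_EFinB _ _ _ mu D a b mD ia ib.
rewrite /abel -RintegralD//; [|exact: integrable_abel..].
rewrite -mulrDr -RintegralD//; [|exact: integrable_abel..].
rewrite -RintegralZl//; last by apply: integrable_EFinD => //; exact: integrable_abel.
by apply: eq_Rintegral => t _; rewrite cosTD// cosTB// sinTD// sinTB//; ring.
Qed.

Lemma continuous_poisson_convolution e a : 0 < e -> mu.-integrable D (EFin \o a) ->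
  continuous (fun x => \int[mu]_(y in D) (a y * poisson e (x - y))).
Proof.
move=> e0 ia.
apply: (@continuous_Rintegral_kernel _ _ _ mu D a (fun x y => poisson e (x - y)) e^-1) => //.
- move=> x; apply: measurableT_comp; first exact: measurable_poisson.
  exact: measurable_funB.
- by move=> x y; rewrite ger0_norm ?poisson_ge0// poisson_le.
- move=> y x; apply: (@continuous_comp R R R (fun z => z - y) (poisson e) x).
    by apply: cvgB; [exact: cvg_id|exact: cvg_cst].
  exact: continuous_poisson.
Qed.

Lemma poissonN e x : poisson e (- x) = poisson e x.
Proof. by rewrite /poisson sqrrN. Qed.

Lemma Rintegral_poisson_le e x : 0 < e -> \int[mu]_(y in D) poisson e (x - y) <= pi.
Proof.
move=> e0; have ip := integrable_poisson x e0.
rewrite -(Rintegral_poisson x e0) -lee_fin !EFin_Rintegral//; last first.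
  exact: integrableS ip.
apply: ge0_subset_integral => //.
- by apply: measurableT_comp => //; case/integrableP : ip => /measurable_EFinP.
- by move=> y _; rewrite lee_fin poisson_ge0.
Qed.

End transform.
End cosine_sine_transforms.

Lemma mulr_le_half_sqrD (R : realFieldType) (x y p : R) : 0 <= p ->
  x * (y * p) <= 2^-1 * (x ^+ 2 * p) + 2^-1 * (y ^+ 2 * p).
Proof.
move=> p0; have : 0 <= (x - y) ^+ 2 * p by rewrite mulr_ge0 ?sqr_ge0.
lra.
Qed.

(** * Abel means: a uniform bound, and the limit for functions continuous almost everywhere *)

Section half_plancherel.
Context {R : realType}.
Local Notation mu := (@lebesgue_measure R).
Variables (D : set R) (mD : measurable D) (Dfin : (mu D < +oo)%E).
Implicit Types (a b : R -> R) (e x y t : R).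

(* [a x * a y <= (a x ^+ 2 + a y ^+ 2) / 2], and the kernel has mass at most [pi]
   in each variable. *)
Lemma abel_le e a : 0 < e -> sqint D a ->
  abel D e a <= pi * \int[mu]_(x in D) a x ^+ 2.
Proof.
move=> e0 sa; have ia := sqint_integrable mD Dfin sa; have [ma ia2] := sa.
have pe (x y : R) : `|poisson e (x - y)| <= e^-1.
  by rewrite ger0_norm ?poisson_ge0// poisson_le.
have mp (x : R) : measurable_fun D (fun y => poisson e (x - y)).
  apply: measurable_funTS; apply: measurableT_comp; first exact: measurable_poisson.
  exact: measurable_funB.
have ip (x : R) : mu.-integrable D (EFin \o (fun y => poisson e (x - y))).
  exact: integrableS (integrable_poisson x e0).
pose h x := \int[mu]_(y in D) (a y * poisson e (x - y)).
pose h2 x := \int[mu]_(y in D) (a y ^+ 2 * poisson e (x - y)).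
pose h1 x := \int[mu]_(y in D) poisson e (x - y).
have ch := continuous_poisson_convolution mD e0 ia.
have ch2 := continuous_poisson_convolution mD e0 ia2.
have i1 : mu.-integrable D (EFin \o cst 1) by exact: integrable_EFin_cst.
have ch1 : continuous h1.
  have := continuous_poisson_convolution mD e0 i1.
  rewrite /h1; under [X in continuous X]eq_fun do under eq_Rintegral do rewrite mul1r.
  exact.
have iah : mu.-integrable D (EFin \o (fun x => a x * h x)).
  apply: (@integrable_EFinM_bounded _ _ _ mu D _ _ (\int[mu]_(y in D) `|a y| * e^-1)) => //.
    by apply: measurable_funTS; exact: continuous_measurable_fun.
  move=> x Dx; apply: (@Rintegral_le_bound _ _ _ mu D a (fun y => poisson e (x - y))) => //.
  exact: mp.
have iah1 : mu.-integrable D (EFin \o (fun x => a x ^+ 2 * h1 x)).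
  apply: (@integrable_EFinM_bounded _ _ _ mu D _ _ pi) => //.
    by apply: measurable_funTS; exact: continuous_measurable_fun.
  move=> x Dx; rewrite ger0_norm; first exact: Rintegral_poisson_le.
  by apply: Rintegral_ge0 => y _; exact: poisson_ge0.
have ih2 : mu.-integrable D (EFin \o h2).
  apply: (@integrable_EFin_le _ _ _ mu D _ (cst (\int[mu]_(y in D) `|a y ^+ 2| * e^-1))) => //.
  - by apply: measurable_funTS; exact: continuous_measurable_fun.
  - exact: integrable_EFin_cst.
  - move=> x Dx.
    apply: (@Rintegral_le_bound _ _ _ mu D (fun y => a y ^+ 2) (fun y => poisson e (x - y))) => //.
    exact: mp.
have h1pi : \int[mu]_(x in D) (a x ^+ 2 * h1 x) <= pi * \int[mu]_(x in D) a x ^+ 2.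
  rewrite -RintegralZl//; apply: le_Rintegral => //; first exact: integrable_EFinZl.
  by move=> x Dx; rewrite mulrC ler_wpM2r ?sqr_ge0// Rintegral_poisson_le.
(* Since the kernel is even, Fubini makes the contribution of [a y ^+ 2] equal to that of
   [a x ^+ 2]. *)
have h2E : \int[mu]_(x in D) h2 x = \int[mu]_(x in D) (a x ^+ 2 * h1 x).
  have mk : measurable_fun setT (fun z : R * R => poisson e (z.1 - z.2)).
    apply: measurableT_comp; first exact: measurable_poisson.
    exact: measurable_funB.
  have kB (z : R * R) : `|poisson e (z.1 - z.2)| <= e^-1 by exact: pe.
  have := @Rintegral_swap _ _ _ _ R mu mu D D (cst 1) (fun x => a x ^+ 2)
    (fun z => poisson e (z.1 - z.2)) e^-1 mD mD i1 ia2 mk kB.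
  under eq_Rintegral do rewrite mul1r.
  move=> ->; apply: eq_Rintegral => y _; congr (_ * _); apply: eq_Rintegral => x _.
  by rewrite mul1r/= -opprB poissonN.
rewrite (abel_poisson mD e0 ia).
apply: (@le_trans _ _ (\int[mu]_(x in D) (2^-1 * (a x ^+ 2 * h1 x) + 2^-1 * h2 x))).
  apply: le_Rintegral => //.
    by apply: integrable_EFinD => //; exact: integrable_EFinZl.
  move=> x Dx.
  have iap : mu.-integrable D (EFin \o (fun y => a y * poisson e (x - y))).
    exact: (@integrable_EFinM_bounded _ _ _ mu D a (fun y => poisson e (x - y)) e^-1
      mD ia (mp x) (fun y _ => pe x y)).
  have ia2p : mu.-integrable D (EFin \o (fun y => a y ^+ 2 * poisson e (x - y))).
    exact: (@integrable_EFinM_bounded _ _ _ mu D (fun y => a y ^+ 2) (fun y => poisson e (x - y)) e^-1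
      mD ia2 (mp x) (fun y _ => pe x y)).
  rewrite -/(h x) /h /h1 /h2 -!RintegralZl// -?RintegralD//; last 3 first.
  - by apply: integrable_EFinZl => //; exact: integrable_EFinZl.
  - exact: integrable_EFinZl.
  - exact: integrable_EFinZl.
  apply: le_Rintegral => //.
  - exact: integrable_EFinZl.
  - by apply: integrable_EFinD => //; apply: integrable_EFinZl => //; exact: integrable_EFinZl.
  move=> y _.
  have p0 := poisson_ge0 (x - y) e0.
  exact: mulr_le_half_sqrD.
rewrite RintegralD//; [|exact: integrable_EFinZl..].
by rewrite RintegralZl// RintegralZl// h2E !(mulrC 2^-1) -splitr.
Qed.

(** By [abel_poisson] the mean is the integral of [c] against its Poisson convolution over [D],
    which is a convolution over the line of the extension by zero. Continuity is therefore asked of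
    [c \_ D]: there the convolution tends to [pi * c x], and dominated convergence concludes. *)
Lemma abel_cvg_continuous (c : R -> R) (M : R) : measurable_fun setT c ->
  (forall x, `|c x| <= M) -> {ae mu, forall x, D x -> {for x, continuous (c \_ D)}} ->
  abel D n.+1%:R^-1 c @[n --> \oo] --> pi * \int[mu]_(x in D) c x ^+ 2.
Proof.
move=> mc cM cc.
have mcD : measurable_fun D c by exact: measurable_funTS.
have sc : sqint D c by exact: (@bounded_sqint _ _ mD Dfin _ M).
have ic := sqint_integrable mD Dfin sc.
have n0 n : 0 < n.+1%:R^-1 :> R by rewrite invr_gt0.
have M0 : 0 <= M by exact: le_trans (cM 0).
pose h n x := \int[mu]_(y in D) (c y * poisson n.+1%:R^-1 (x - y)).
have -> : (fun n => abel D n.+1%:R^-1 c) = (fun n => \int[mu]_(x in D) (c x * h n x)).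
  by apply/funext => n; rewrite (abel_poisson mD (n0 n) ic).
have -> : pi * \int[mu]_(x in D) c x ^+ 2 = \int[mu]_(x in D) (c x * (pi * c x)).
  rewrite -RintegralZl//; last by case: sc.
  by apply: eq_Rintegral => x _; rewrite expr2 mulrCA.
have mhn n : measurable_fun D (h n).
  apply: measurable_funTS; apply: continuous_measurable_fun.
  exact: (continuous_poisson_convolution mD (n0 n) ic).
apply: (@Rintegral_dominated_cvg _ _ _ mu D _ _ (cst (M * (pi * M)))) => //.
- by move=> n; apply: measurable_funM; [exact: mcD|exact: mhn].
- by apply: measurable_funM => //; exact: measurable_funM.
- apply: ae_imply cc => x cx Dx; apply: cvgM; first exact: cvg_cst.
  have mcD' : measurable_fun setT (c \_ D).
    exact/(measurable_restrict _ mD measurableT)/measurable_funTS.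
  have cDM y : `|(c \_ D) y| <= M.
    by rewrite patchE; case: ifPn => _ //; rewrite normr0.
  have -> : (fun n => h n x) = (fun n => \int[mu]_y (poisson n.+1%:R^-1 (x - y) * (c \_ D) y)).
    apply/funext => n; rewrite /h [LHS]Rintegral_mkcond; apply: eq_Rintegral => y _.
    by rewrite !patchE; case: ifPn => _; rewrite ?mulr0// mulrC.
  have -> : c x = (c \_ D) x by rewrite patchE mem_set.
  exact: (cvg_poisson mcD' cDM (cx Dx)).
- exact: integrable_EFin_cst.
- move=> n x Dx /=; rewrite normrM ler_pM//.
  have ip : mu.-integrable D (EFin \o (fun y => poisson n.+1%:R^-1 (x - y))).
    exact: integrableS (integrable_poisson x (n0 n)).
  have -> : h n x = \int[mu]_(y in D) (poisson n.+1%:R^-1 (x - y) * c y).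
    by apply: eq_Rintegral => y _; rewrite mulrC.
  have := @Rintegral_le_bound _ _ _ mu D _ c M mD ip mcD (fun y _ => cM y).
  move=> /le_trans; apply; rewrite ler_wpM2r//.
  apply: le_trans (Rintegral_poisson_le mD x (n0 n)).
  apply: le_Rintegral => //; first exact: integrable_norm.
  by move=> y _; rewrite ger0_norm ?poisson_ge0.
Qed.

End half_plancherel.

(** * Plancherel's identity on the half-line for real functions on a segment *)

Section half_line_plancherel.
Context {R : realType}.
Local Notation mu := (@lebesgue_measure R).
Variables (u v : R).
Local Notation D := (`[u, v]%classic : set R).
Implicit Types (a b : R -> R) (e x y t : R).

Let mD : measurable D. Proof. by []. Qed.

Lemma lebesgue_measure_itvcc_lty : (mu D < +oo)%E.
Proof. by rewrite lebesgue_measure_itv/=; case: ifPn => _; rewrite ?ltry// -EFinB ltry. Qed.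

Let Dfin := lebesgue_measure_itvcc_lty.

(** The extension by zero can jump only at the endpoints [u] and [v], which form a null set. *)
Lemma ae_continuous_patch_itv (c : R -> R) : continuous c ->
  {ae mu, forall x, D x -> {for x, continuous (c \_ D)}}.
Proof.
move=> cc; exists [set u; v]; split => //.
- exact: measurableU.
- by apply: countable_lebesgue_measure0; apply: finite_set_countable; exact: finite_set2.
- move=> x /= /not_implyP[Dx ncx]; apply: contrapT => /not_orP[/eqP xu /eqP xv]; apply: ncx.
  move: Dx; rewrite /= in_itv/= => /andP[ux xv'].
  have xI : x \in `]u, v[ by rewrite in_itv/= !lt_neqAle eq_sym xu ux xv xv'.
  rewrite /prop_for /continuous_at patchE mem_set/=; last by rewrite in_itv/= ux.
  apply: cvg_trans (cc x); apply: near_eq_cvg.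
  near=> y; rewrite patchE mem_set//.
  have : y \in `]u, v[ by near: y; exact: near_in_itvoo.
  by rewrite /= !in_itv/= => /andP[/ltW -> /ltW ->].
Unshelve. all: by end_near. Qed.

(* The defect [pi * \int a ^ 2 - abel e a] is a nonnegative quadratic form, so by the
   parallelogram law the defect of [a] is at most twice those of [c] and [a - c]. *)
Lemma abel_cvg a : sqint D a ->
  abel D n.+1%:R^-1 a @[n --> \oo] --> pi * \int[mu]_(x in D) a x ^+ 2.
Proof.
move=> sa; apply/cvgrPdist_le => tau tau0.
have pi0 : 0 < pi :> R := pi_gt0 R.
have t1 : 0 < tau / 4 / pi by rewrite !divr_gt0.
have [c [M [cc cM ac]]] := sqint_continuous_approx mD Dfin sa t1.
have mc : measurable_fun setT c by exact: continuous_measurable_fun.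
have sc : sqint D c.
  by apply: (@bounded_sqint _ _ mD Dfin _ M) => //; exact: measurable_funTS.
have sd := sqintB mD sa sc.
pose d x := a x - c x.
(* The parallelogram law is applied to [c] and [d], whose sum is [a]. The defect of [c - d] is
   nonnegative by [abel_le], so that of [a] is at most twice the defect of [c], below [tau / 4],
   plus twice [pi * \int d ^ 2], also below [tau / 4]. *)
have sb : sqint D (fun x => c x - d x) by exact: (sqintB mD sc sd).
have ia := sqint_integrable mD Dfin sa; have ic := sqint_integrable mD Dfin sc.
have id := sqint_integrable mD Dfin sd.
have t2 : 0 < tau / 4 by rewrite divr_gt0.
have /cvgrPdist_le/(_ _ t2)[N _ cN] :=
  abel_cvg_continuous mD Dfin mc cM (ae_continuous_patch_itv cc).
exists N => // n /cN /=.
have n0 : 0 < n.+1%:R^-1 :> R by rewrite invr_gt0.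
have := abel_parallelogram mD n0 ic id.
have -> : (fun x => c x + (a x - c x)) = a by apply/funext => x; rewrite addrC subrK.
have Epar : \int[mu]_(x in D) a x ^+ 2 + \int[mu]_(x in D) (c x - d x) ^+ 2 =
    2 * \int[mu]_(x in D) c x ^+ 2 + 2 * \int[mu]_(x in D) (a x - c x) ^+ 2.
  have [_ i1] := sa; have [_ i2] := sb; have [_ i3] := sc; have [_ i4] := sd.
  rewrite -RintegralD// -RintegralZl// -RintegralZl// -RintegralD//; [|exact: integrable_EFinZl..].
  by apply: eq_Rintegral => x _; rewrite /d; ring.
have := abel_le mD Dfin n0 sb.
have := abel_le mD Dfin n0 sa.
have := abel_ge0 D n.+1%:R^-1 (fun x => a x - c x).
move: Epar ac.
move: (\int[mu]_(x in D) a x ^+ 2) (\int[mu]_(x in D) c x ^+ 2).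
move: (\int[mu]_(x in D) (a x - c x) ^+ 2) (\int[mu]_(x in D) (c x - d x) ^+ 2).
move: (abel D _ (fun x => a x - c x)) (abel D _ (fun x => c x - d x)) (abel D _ a) (abel D _ c).
clear - pi0 tau0; move=> Ad Ab Aa Ac Id Ib Ia Ic Epar Idle Ad0 Aale Able par.
have Id' : pi * Id <= tau / 4.
  by rewrite mulrC -ler_pdivlMr.
rewrite !ler_norml => /andP[h1 h2].
have : pi * Ia + pi * Ib = 2 * (pi * Ic) + 2 * (pi * Id) by rewrite -mulrDr Epar; ring.
move: Id' h1 h2 Aale Able; move: (pi * Id) (pi * Ia) (pi * Ib) (pi * Ic) => p q r s.
move=> *; apply/andP; split; lra.
Qed.

(** For nonnegative [t] the weights $e^{-t/(n+1)}$ increase to 1, so monotone convergence identifies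
    the integral with the limit of the Abel means, given by [abel_cvg]. *)
Lemma half_plancherel a : sqint D a ->
  (\int[mu]_(t in `[0%R, +oo[) (cosT D a t ^+ 2 + sinT D a t ^+ 2)%:E =
   (pi * \int[mu]_(x in D) a x ^+ 2)%:E)%E.
Proof.
move=> sa; have ia := sqint_integrable mD Dfin sa.
pose W t := cosT D a t ^+ 2 + sinT D a t ^+ 2.
have W0 t : 0 <= W t by rewrite addr_ge0 ?sqr_ge0.
have n0 n : 0 < n.+1%:R^-1 :> R by rewrite invr_gt0.
pose g n t : \bar R := (expR (- (n.+1%:R^-1 * t)) * W t)%:E.
have gW t : g n t @[n --> \oo] --> (W t)%:E.
  apply: cvg_EFin; first exact: nearW.
  rewrite -[X in _ --> X]mul1r; apply: cvgM; last exact: cvg_cst.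
  rewrite [X in _ --> X](_ : 1 = expR (- (0 * t))); last by rewrite mul0r oppr0 expR0.
  apply: continuous_cvg; first exact: continuous_expR.
  apply: cvgN; apply: cvgM; last exact: cvg_cst.
  exact: cvg_harmonic.
have mg n : measurable_fun (`[0%R, +oo[ : set R) (g n).
  by case/integrableP : (integrable_abel mD (n0 n) ia).
have := @cvg_monotone_convergence _ _ _ mu `[0%R, +oo[%classic _ g mg _ _.
have -> : (\int[mu]_(t in `[0%R, +oo[) (fun x0 => limn (g ^~ x0)) t =
    \int[mu]_(t in `[0%R, +oo[) (W t)%:E)%E.
  by apply: eq_integral => t _; apply/cvg_lim => //; exact: gW.
move=> h.
transitivity (limn (fun n => \int[mu]_(t in `[0%R, +oo[) g n t)%E).
  apply/esym/cvg_lim => //; apply: h => //.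
  - by move=> n t _; rewrite lee_fin mulr_ge0 ?expR_ge0.
  - move=> t /=; rewrite in_itv/= andbT => t0 m n mn; rewrite lee_fin ler_wpM2r//.
    by rewrite ler_expR lerN2 ler_wpM2r// lef_pV2 ?posrE// ler_nat ltnS.
have -> : (fun n => \int[mu]_(t in `[0%R, +oo[) g n t)%E = (fun n => (abel D n.+1%:R^-1 a)%:E).
  by apply/funext => n; rewrite /abel EFin_Rintegral//; exact: (integrable_abel mD (n0 n) ia).
by apply/cvg_lim => //; apply: cvg_EFin; [exact: nearW|exact: abel_cvg].
Qed.

End half_line_plancherel.

(** * Plancherel's identity on the line *)

Section continuous_real_functions.
Context {R : realType}.
Implicit Types f g : R -> R.

Lemma continuous_fun_add f g : continuous f -> continuous g ->
  continuous (fun x => f x + g x).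
Proof. by move=> cf cg x; apply: cvgD; [exact: cf|exact: cg]. Qed.

Lemma continuous_fun_sub f g : continuous f -> continuous g ->
  continuous (fun x => f x - g x).
Proof. by move=> cf cg x; apply: cvgB; [exact: cf|exact: cg]. Qed.

End continuous_real_functions.

Section plancherel.
Context {R : realType}.
Local Notation mu := (@lebesgue_measure R).
Implicit Types (D E : set R) (a b p q : R -> R) (x y t u v : R).

Lemma ge0_integral_fold (f : R -> \bar R) : measurable_fun setT f ->
  (forall x, 0 <= f x)%E ->
  (\int[mu]_x f x = \int[mu]_(x in `[0%R, +oo[) (f x + f (- x)%R))%E.
Proof.
move=> mf f0.
have mfN : measurable_fun setT (fun x => f (- x)).
  by apply: measurableT_comp mf _; exact: measurable_funN.
rewrite ge0_integralD//; [|exact: measurable_funTS..].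
rewrite (ge0_integration_by_substitution0 mfN)//.
under [X in (_ + X)%E]eq_integral do rewrite opprK.
rewrite -(setUv (`[0%R, +oo[%classic : set R)) ge0_integral_setU//=.
- congr (_ + _)%E; rewrite setCitvr integral_itv_bndo_bndc//.
  exact: measurable_funTS.
- exact: measurableC.
- by rewrite setUv.
- exact/disj_setPCl.
Qed.

Lemma cosTN D a t : cosT D a (- t) = cosT D a t.
Proof. by apply: eq_Rintegral => y _; rewrite mulNr cosN. Qed.

Lemma sinTN D a t : measurable D -> mu.-integrable D (EFin \o a) ->
  sinT D a (- t) = - sinT D a t.
Proof.
move=> mD ia; rewrite -[RHS]mulN1r /sinT -RintegralZl//; last exact: integrable_Msin.
by apply: eq_Rintegral => y _; rewrite mulNr sinN mulrN mulN1r.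
Qed.

(** The two squares are those of the real and imaginary parts of $\int e^{ity} (a + ib)(y)\,dy$.
    Folding [t] onto [- t] cancels the cross terms between [a] and [b], and each of the two
    functions then contributes by [half_plancherel]. *)
Lemma plancherel_pair u v a b : let D := `[u, v]%classic : set R in
  sqint D a -> sqint D b ->
  (\int[mu]_t ((cosT D a t - sinT D b t) ^+ 2 + (sinT D a t + cosT D b t) ^+ 2)%:E =
   (2 * pi * \int[mu]_(x in D) (a x ^+ 2 + b x ^+ 2))%:E)%E.
Proof.
move=> D sa sb; have mD : measurable D by exact: measurable_itv.
have Dfin := lebesgue_measure_itvcc_lty u v.
have ia := sqint_integrable mD Dfin sa; have ib := sqint_integrable mD Dfin sb.
have mca := measurable_cosT mD ia; have mcb := measurable_cosT mD ib.
have msa := measurable_sinT mD ia; have msb := measurable_sinT mD ib.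
rewrite ge0_integral_fold; last 2 first.
- apply/measurable_EFinP; apply: measurable_funD; apply: measurable_funX.
    exact: measurable_funB.
  exact: measurable_funD.
- by move=> x; rewrite lee_fin addr_ge0 ?sqr_ge0.
have mW (c : R -> R) : measurable_fun setT (cosT D c) -> measurable_fun setT (sinT D c) ->
    measurable_fun (`[0%R, +oo[ : set R) (fun t => (cosT D c t ^+ 2 + sinT D c t ^+ 2)%:E).
  move=> m1 m2; apply/measurable_EFinP; apply: measurable_funTS.
  by apply: measurable_funD; apply: measurable_funX.
have W0 (c : R -> R) (t : R) : (0 <= (cosT D c t ^+ 2 + sinT D c t ^+ 2)%:E)%E.
  by rewrite lee_fin addr_ge0 ?sqr_ge0.
transitivity (\int[mu]_(t in `[0%R, +oo[)
   (2%:E * ((cosT D a t ^+ 2 + sinT D a t ^+ 2)%:E + (cosT D b t ^+ 2 + sinT D b t ^+ 2)%:E)))%E.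
  apply: eq_integral => t _; rewrite !cosTN !sinTN// -!EFinD -EFinM; congr EFin; ring.
rewrite ge0_integralZl//; last 2 first.
- by apply: emeasurable_funD; exact: mW.
- by move=> t _; exact: adde_ge0.
rewrite ge0_integralD//; [|exact: mW..].
rewrite half_plancherel// half_plancherel// -EFinD -EFinM; congr EFin.
rewrite RintegralD//; [ring|by case: sa|by case: sb].
Qed.

Lemma cosT_dual D E a p : measurable D -> measurable E ->
  mu.-integrable D (EFin \o a) -> mu.-integrable E (EFin \o p) ->
  \int[mu]_(y in D) (a y * cosT E p y) = \int[mu]_(x in E) (p x * cosT D a x).
Proof.
move=> mD mE ia ip.
have mk : measurable_fun setT (fun z : R * R => cos (z.1 * z.2)).
  apply: measurableT_comp; last exact: measurable_funM.
  by apply: continuous_measurable_fun; exact: continuous_cos.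
have k1 (z : R * R) : `|cos (z.1 * z.2)| <= 1 by exact: cos_norm_le1.
have := @Rintegral_swap _ _ _ _ R mu mu D E a p _ 1 mD mE ia ip mk k1.
move=> /= ->; apply: eq_Rintegral => x _; congr (_ * _).
by apply: eq_Rintegral => y _; rewrite (mulrC y).
Qed.

Lemma sinT_dual D E a p : measurable D -> measurable E ->
  mu.-integrable D (EFin \o a) -> mu.-integrable E (EFin \o p) ->
  \int[mu]_(y in D) (a y * sinT E p y) = \int[mu]_(x in E) (p x * sinT D a x).
Proof.
move=> mD mE ia ip.
have mk : measurable_fun setT (fun z : R * R => sin (z.1 * z.2)).
  apply: measurableT_comp; last exact: measurable_funM.
  by apply: continuous_measurable_fun; exact: continuous_sin.
have k1 (z : R * R) : `|sin (z.1 * z.2)| <= 1 by exact: sin_norm_le1.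
have := @Rintegral_swap _ _ _ _ R mu mu D E a p _ 1 mD mE ia ip mk k1.
move=> /= ->; apply: eq_Rintegral => x _; congr (_ * _).
by apply: eq_Rintegral => y _; rewrite (mulrC y).
Qed.

(** * The inversion error in terms of real and imaginary parts *)

Section inversion.
Variables (u v : R) (a b : R -> R).
Let D := `[u, v]%classic : set R.
Hypotheses (sa : sqint D a) (sb : sqint D b).

Let mD : measurable D. Proof. exact: measurable_itv. Qed.
Let Dfin : (mu D < +oo)%E. Proof. exact: lebesgue_measure_itvcc_lty. Qed.
Let ia := sqint_integrable mD Dfin sa.
Let ib := sqint_integrable mD Dfin sb.

(** [p] and [q] are the real and imaginary parts of $\int_D e^{-ix\eta} (a + ib)(\eta)\,d\eta$. *)
Let p x := cosT D a x + sinT D b x.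
Let q x := cosT D b x - sinT D a x.

Lemma continuous_inverse_re : continuous p.
Proof.
exact: (continuous_fun_add (continuous_cosT mD ia) (continuous_sinT mD ib)).
Qed.

Lemma continuous_inverse_im : continuous q.
Proof.
exact: (continuous_fun_sub (continuous_cosT mD ib) (continuous_sinT mD ia)).
Qed.

Let cp := continuous_inverse_re.
Let cq := continuous_inverse_im.

Lemma continuous_sqint (c : R -> R) x y : continuous c -> sqint (`[x, y]%classic : set R) c.
Proof.
move=> cc; split.
  by apply: measurable_funTS; exact: continuous_measurable_fun.
apply: continuous_compact_integrable; first exact: segment_compact.
apply: continuous_subspaceT => z; apply: (@continuous_comp R R R c (fun t => t ^+ 2)).
  exact: cc.
exact: exprn_continuous.
Qed.

(** The sign of the exponent is reversed by exchanging [a] and [b]: the forward transform of $b +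
    ia$ has real part [q] and imaginary part [p]. *)
Lemma plancherel_inverse :
  (\int[mu]_x (p x ^+ 2 + q x ^+ 2)%:E =
   (2 * pi * \int[mu]_(x in D) (a x ^+ 2 + b x ^+ 2))%:E)%E.
Proof.
under [X in (2 * pi * X)%:E]eq_Rintegral do rewrite addrC.
rewrite -(plancherel_pair sb sa); apply: eq_integral => x _; congr EFin.
by rewrite /p /q addrC [cosT _ _ _ + sinT _ _ _]addrC.
Qed.

(** Monotone convergence along the segments $[-n, n]$, which exhaust the line. *)
Lemma cvg_plancherel_inverse :
  \int[mu]_(x in `[- n%:R, n%:R]) (p x ^+ 2 + q x ^+ 2) @[n --> \oo] -->
  2 * pi * \int[mu]_(x in D) (a x ^+ 2 + b x ^+ 2).
Proof.
have mpq : measurable_fun setT (fun x => (p x ^+ 2 + q x ^+ 2)%:E).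
  apply/measurable_EFinP; apply: measurable_funD; apply: measurable_funX;
    exact: continuous_measurable_fun.
pose I (n : nat) : set R := `[- n%:R, n%:R]%classic.
suff : (\int[mu]_(x in I n) (p x ^+ 2 + q x ^+ 2)%:E @[n --> \oo] -->
  (2 * pi * \int[mu]_(x in D) (a x ^+ 2 + b x ^+ 2))%:E)%E by move=> /fine_cvg.
rewrite -plancherel_inverse.
have -> : [set: R] = \bigcup_(n : nat) I n.
  apply/seteqP; split=> // x _; exists (Num.bound `|x|) => //=.
  by rewrite /I/= in_itv/= -ler_norml ltW// archi_boundP.
apply: (@ge0_nondecreasing_set_cvg_integral _ (measurableTypeR R) R I) => //.
- apply/nondecreasing_seqP => n; apply/subsetPset => x; rewrite /I/= !in_itv/= => /andP[h1 h2]; apply/andP; split.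
    by apply: le_trans h1; rewrite lerN2 ler_nat.
  by apply: le_trans h2 _; rewrite ler_nat.
- by move=> n; exact: measurable_itv.
- by move=> n; exact: measurable_funTS.
- by move=> ? x _; rewrite lee_fin addr_ge0 ?sqr_ge0.
Qed.

Variable n : nat.
Let E := `[- n%:R, n%:R]%classic : set R.
(** [X] and [Y] are the real and imaginary parts of the truncated Fourier transform of $p + iq$. *)
Let X t := (2 * pi)^-1 * (cosT E p t - sinT E q t).
Let Y t := (2 * pi)^-1 * (sinT E p t + cosT E q t).

(** The square is expanded. With [k = (2 * pi)^-1], Plancherel on [E] gives [k] times the energy of
    $p + iq$ on [E] for the squared transform, and the cross term is minus twice the same
    quantity. *)
Lemma inversion_error : (forall x, ~ D x -> a x = 0) -> (forall x, ~ D x -> b x = 0) ->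
  (\int[mu]_t ((X t - a t) ^+ 2 + (Y t - b t) ^+ 2)%:E =
   (\int[mu]_(x in D) (a x ^+ 2 + b x ^+ 2) -
    (2 * pi)^-1 * \int[mu]_(x in E) (p x ^+ 2 + q x ^+ 2))%:E)%E.
Proof.
move=> a0 b0; set k := (2 * pi)^-1.
have mE : measurable E by exact: measurable_itv.
have Efin : (mu E < +oo)%E by exact: lebesgue_measure_itvcc_lty.
have sp : sqint E p by exact: continuous_sqint.
have sq : sqint E q by exact: continuous_sqint.
have ip := sqint_integrable mE Efin sp; have iq := sqint_integrable mE Efin sq.
pose x0 t := cosT E p t - sinT E q t; pose y0 t := sinT E p t + cosT E q t.
have cx0 : continuous x0.
  exact: (continuous_fun_sub (continuous_cosT mE ip) (continuous_sinT mE iq)).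
have cy0 : continuous y0.
  exact: (continuous_fun_add (continuous_sinT mE ip) (continuous_cosT mE iq)).
have F2 := plancherel_pair sp sq.
have iF : mu.-integrable setT (EFin \o (fun t => x0 t ^+ 2 + y0 t ^+ 2)).
  apply/integrableP; split.
    apply/measurable_EFinP; apply: measurable_funD; apply: measurable_funX;
      exact: continuous_measurable_fun.
  under eq_integral do rewrite /= ger0_norm ?addr_ge0 ?sqr_ge0//.
  by rewrite F2 ltry.
have toD (f : R -> R) : (forall x, ~ D x -> f x = 0) -> f = f \_ D.
  move=> f0; apply/funext => x; rewrite patchE; case: ifPn => // /negP nDx.
  by rewrite f0// => Dx; apply: nDx; exact/mem_set.
have iab : mu.-integrable D (EFin \o (fun t => a t ^+ 2 + b t ^+ 2)).
  by apply: integrable_EFinD; [by []|case: sa|case: sb].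
have sx0 : sqint D x0 by exact: continuous_sqint.
have sy0 : sqint D y0 by exact: continuous_sqint.
have iax := sqintM_integrable mD sa sx0.
have iby := sqintM_integrable mD sb sy0.
have icr : mu.-integrable D (EFin \o (fun t => a t * x0 t + b t * y0 t)).
  exact: (@integrable_EFinD _ _ _ mu).
have extend (f : R -> R) : (forall x, ~ D x -> f x = 0) -> mu.-integrable D (EFin \o f) ->
    mu.-integrable setT (EFin \o f) /\ \int[mu]_x f x = \int[mu]_(x in D) f x.
  move=> f0 fi; split; last by rewrite [RHS]Rintegral_mkcond -toD.
  rewrite (toD f f0) -restrict_EFin; apply/integrable_restrict => //.
  by rewrite setTI.
have [iabT abE] : mu.-integrable setT (EFin \o (fun t => a t ^+ 2 + b t ^+ 2)) /\
    \int[mu]_x (a x ^+ 2 + b x ^+ 2) = \int[mu]_(x in D) (a x ^+ 2 + b x ^+ 2).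
  by apply: extend => // x nDx; rewrite a0// b0// expr0n addr0.
have [icrT crE] : mu.-integrable setT (EFin \o (fun t => a t * x0 t + b t * y0 t)) /\
    \int[mu]_x (a x * x0 x + b x * y0 x) = \int[mu]_(x in D) (a x * x0 x + b x * y0 x).
  by apply: extend => // x nDx; rewrite a0// b0// !mul0r addr0.
(* The duality lemmas move each transform from [p], [q] on [E] to [a], [b] on [D], where the four
   terms reassemble into [p] and [q] themselves. *)
have cross : \int[mu]_(x in D) (a x * x0 x + b x * y0 x) =
    \int[mu]_(x in E) (p x ^+ 2 + q x ^+ 2).
  rewrite /x0 /y0.
  have iap := sqintM_integrable mD sa (continuous_sqint u v (continuous_cosT mE ip)).
  have iaq := sqintM_integrable mD sa (continuous_sqint u v (continuous_sinT mE iq)).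
  have ibp := sqintM_integrable mD sb (continuous_sqint u v (continuous_sinT mE ip)).
  have ibq := sqintM_integrable mD sb (continuous_sqint u v (continuous_cosT mE iq)).
  have ipa := sqintM_integrable mE sp (continuous_sqint _ _ (continuous_cosT mD ia)).
  have iqa := sqintM_integrable mE sq (continuous_sqint _ _ (continuous_sinT mD ia)).
  have ipb := sqintM_integrable mE sp (continuous_sqint _ _ (continuous_sinT mD ib)).
  have iqb := sqintM_integrable mE sq (continuous_sqint _ _ (continuous_cosT mD ib)).
  rewrite RintegralD//.
  under eq_Rintegral do rewrite mulrBr.
  under [X in _ + X = _]eq_Rintegral do rewrite mulrDr.
  rewrite RintegralB// RintegralD// (cosT_dual mD mE ia ip)
    (sinT_dual mD mE ia iq) (sinT_dual mD mE ib ip) (cosT_dual mD mE ib iq).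
  have -> : \int[mu]_(x in E) (p x ^+ 2 + q x ^+ 2) =
     \int[mu]_(x in E) ((p x * cosT D a x - q x * sinT D a x) +
                        (p x * sinT D b x + q x * cosT D b x)).
    by apply: eq_Rintegral => x _; rewrite /p /q; ring.
  rewrite RintegralD//; last 2 first.
  - exact: (@integrable_EFinB _ _ _ mu).
  - exact: (@integrable_EFinD _ _ _ mu).
  by rewrite RintegralB// RintegralD//.
have iF2 := @integrable_EFinZl _ _ _ mu setT _ (k ^+ 2) measurableT iF.
have icr2 := @integrable_EFinZl _ _ _ mu setT _ (2 * k) measurableT icrT.
have i12 := @integrable_EFinB _ _ _ mu setT _ _ measurableT iF2 icr2.
have i123 := @integrable_EFinD _ _ _ mu setT _ _ measurableT i12 iabT.
transitivity ((\int[mu]_t (k ^+ 2 * (x0 t ^+ 2 + y0 t ^+ 2) -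
    2 * k * (a t * x0 t + b t * y0 t) + (a t ^+ 2 + b t ^+ 2)))%:E).
  rewrite EFin_Rintegral//; apply: eq_integral => t _; congr EFin.
  by rewrite /X /Y -/(x0 t) -/(y0 t) -/k; ring.
congr EFin; rewrite RintegralD// RintegralB// RintegralZl// RintegralZl// abE crE cross.
have -> : \int[mu]_t (x0 t ^+ 2 + y0 t ^+ 2) = 2 * pi * \int[mu]_(x in E) (p x ^+ 2 + q x ^+ 2).
  by rewrite /Rintegral F2.
have : k * (2 * pi) = 1 by rewrite /k mulVf// mulf_neq0// gt_eqF// pi_gt0.
move: (\int[mu]_(x in E) _) (\int[mu]_(x in D) _) => e1 e2.
move: (2 * pi : R) (k) => c r rc.
have -> : r ^+ 2 * (c * e1) = (r * c) * r * e1 by ring.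
by rewrite rc; ring.
Qed.

End inversion.

End plancherel.

(** * The complex Fourier transform in L^2 *)

Local Open Scope complex_scope.
Import Normc.

Section fourier_inversion.
Context {R : realType}.
Local Notation mu := (@lebesgue_measure R).
Implicit Types (g h : R -> R[i]) (x t u v : R).

Lemma ReM (x y : R[i]) :
  complex.Re (x * y) = complex.Re x * complex.Re y - complex.Im x * complex.Im y.
Proof. by case: x; case: y. Qed.

Lemma ImM (x y : R[i]) :
  complex.Im (x * y) = complex.Re x * complex.Im y + complex.Im x * complex.Re y.
Proof. by case: x; case: y. Qed.

Lemma ReB (x y : R[i]) : complex.Re (x - y) = complex.Re x - complex.Re y.
Proof. by case: x; case: y. Qed.

Lemma ImB (x y : R[i]) : complex.Im (x - y) = complex.Im x - complex.Im y.
Proof. by case: x; case: y. Qed.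

Lemma sqr_normc (z : R[i]) : normc z ^+ 2 = complex.Re z ^+ 2 + complex.Im z ^+ 2.
Proof. by case: z => x y /=; rewrite sqr_sqrtr// addr_ge0 ?sqr_ge0. Qed.

Lemma measurable_sqr_normc (D : set R) (h : R -> R[i]) :
  measurable_fun D (fun x => complex.Re (h x)) ->
  measurable_fun D (fun x => complex.Im (h x)) ->
  measurable_fun D (fun x => (normc (h x) ^+ 2)%:E).
Proof.
move=> mr mi; apply/measurable_EFinP.
rewrite (_ : (fun x => _) = (fun x => complex.Re (h x) ^+ 2 + complex.Im (h x) ^+ 2)).
  by apply: measurable_funD; exact: measurable_funX.
by apply/funext => x; rewrite sqr_normc.
Qed.

Lemma L2_sqint (D : set R) h : measurable D -> L2 h ->
  sqint D (fun x => complex.Re (h x)) /\ sqint D (fun x => complex.Im (h x)).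
Proof.
move=> mD [mr mi hoo].
have ih : mu.-integrable D (EFin \o (fun x => normc (h x) ^+ 2)).
  apply: (@integrableS _ _ _ mu setT) => //; apply/integrableP; split.
    exact: measurable_sqr_normc.
  by under eq_integral do rewrite /= ger0_norm ?sqr_ge0//.
have mr' : measurable_fun D (fun x => complex.Re (h x)) by exact: measurable_funTS.
have mi' : measurable_fun D (fun x => complex.Im (h x)) by exact: measurable_funTS.
split; split => //; apply: (@integrable_EFin_le _ _ _ mu D _ _ _ _ ih) => //.
- exact: measurable_funX.
- by move=> x _; rewrite sqr_normc ger0_norm ?sqr_ge0// lerDl sqr_ge0.
- exact: measurable_funX.
- by move=> x _; rewrite sqr_normc ger0_norm ?sqr_ge0// lerDr sqr_ge0.
Qed.

Lemma Rintegral_ae_support (D : set R) (f : R -> R) : measurable D ->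
  measurable_fun setT f -> {ae mu, forall x, ~ D x -> f x = 0} ->
  \int[mu]_x f x = \int[mu]_(x in D) f x.
Proof.
move=> mD mf f0; rewrite [RHS]Rintegral_mkcond; congr fine.
apply: ae_eq_integral => //.
- exact/measurable_EFinP.
- apply/measurable_EFinP/(measurable_restrict _ mD measurableT).
  exact: measurable_funTS.
- apply: ae_imply f0 => x f0 _; rewrite patchE; case: ifPn => // /negP nDx.
  by rewrite f0// => Dx; apply: nDx; exact/mem_set.
Qed.

Section trunc.
Variables (g : R -> R[i]) (n : nat).
Let E := `[- n%:R, n%:R]%classic : set R.
Hypothesis gL2 : L2 g.

Let mE : measurable E. Proof. exact: measurable_itv. Qed.
Let Efin : (mu E < +oo)%E. Proof. exact: lebesgue_measure_itvcc_lty. Qed.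
Let ir := sqint_integrable mE Efin (L2_sqint mE gL2).1.
Let ii := sqint_integrable mE Efin (L2_sqint mE gL2).2.

Lemma Re_fourier_trunc t : complex.Re (fourier_trunc n%:R g t) =
  (2 * pi)^-1 * (cosT E (fun x => complex.Re (g x)) t - sinT E (fun x => complex.Im (g x)) t).
Proof.
rewrite /fourier_trunc ReM /= mul0r subr0; congr (_ * _).
rewrite /cosT /sinT -RintegralB//; [|exact: integrable_Mcos|exact: integrable_Msin].
by apply: eq_Rintegral => x _; rewrite ReM /= (mulrC x) [cos _ * _]mulrC [sin _ * _]mulrC.
Qed.

Lemma Im_fourier_trunc t : complex.Im (fourier_trunc n%:R g t) =
  (2 * pi)^-1 * (sinT E (fun x => complex.Re (g x)) t + cosT E (fun x => complex.Im (g x)) t).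
Proof.
rewrite /fourier_trunc ImM /= mul0r addr0; congr (_ * _).
rewrite /cosT /sinT -RintegralD//; [|exact: integrable_Msin|exact: integrable_Mcos].
by apply: eq_Rintegral => x _; rewrite ImM /= (mulrC x) [cos _ * _]mulrC [sin _ * _]mulrC addrC.
Qed.

Lemma measurable_Re_fourier_trunc :
  measurable_fun setT (fun t => complex.Re (fourier_trunc n%:R g t)).
Proof.
under eq_fun do rewrite Re_fourier_trunc.
apply: measurable_funM => //; apply: measurable_funB.
  exact: measurable_cosT.
exact: measurable_sinT.
Qed.

Lemma measurable_Im_fourier_trunc :
  measurable_fun setT (fun t => complex.Im (fourier_trunc n%:R g t)).
Proof.
under eq_fun do rewrite Im_fourier_trunc.
apply: measurable_funM => //; apply: measurable_funD.
  exact: measurable_sinT.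
exact: measurable_cosT.
Qed.

End trunc.

Lemma normcB_sqr_le (x y z : R[i]) :
  normc (x - z) ^+ 2 <= 2 * normc (y - x) ^+ 2 + 2 * normc (y - z) ^+ 2.
Proof.
rewrite !sqr_normc !ReB !ImB.
have := sqrB_triangle (complex.Re x) (complex.Re y) (complex.Re z).
have := sqrB_triangle (complex.Im x) (complex.Im y) (complex.Im z).
by lra.
Qed.

(** Uniqueness of limits in $L^2$: the squared distance of [h1] and [h2] is at most twice the sum of
    their squared distances to the truncated transforms, for every [n], hence it is 0. *)
Lemma is_fourier_unique g h1 h2 : L2 g -> is_fourier g h1 -> is_fourier g h2 ->
  {ae mu, forall t, h1 t = h2 t}.
Proof.
move=> gL2 [[mr1 mi1 _] lim1] [[mr2 mi2 _] lim2].
have mF n (h : R -> R[i]) : measurable_fun setT (fun x => complex.Re (h x)) ->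
    measurable_fun setT (fun x => complex.Im (h x)) ->
    measurable_fun setT (fun t => (normc (fourier_trunc n%:R g t - h t) ^+ 2)%:E).
  move=> mr mi; apply: measurable_sqr_normc.
    under eq_fun do rewrite ReB; apply: measurable_funB => //.
    exact: measurable_Re_fourier_trunc.
  under eq_fun do rewrite ImB; apply: measurable_funB => //.
  exact: measurable_Im_fourier_trunc.
have m12 : measurable_fun setT (fun t => (normc (h1 t - h2 t) ^+ 2)%:E).
  apply: measurable_sqr_normc.
    by under eq_fun do rewrite ReB; exact: measurable_funB.
  by under eq_fun do rewrite ImB; exact: measurable_funB.
have ge0 (f : R -> R[i]) t : (0 <= (normc (f t) ^+ 2)%:E)%E by rewrite lee_fin sqr_ge0.
have I0 : (\int[mu]_t (normc (h1 t - h2 t) ^+ 2)%:E = 0)%E.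
  apply/eqP; rewrite eq_le integral_ge0 ?andbT//; last first.
    by move=> t _; exact: (ge0 (fun t => h1 t - h2 t)).
  have lim12 : (2%:E * \int[mu]_t (normc (fourier_trunc n%:R g t - h1 t) ^+ 2)%:E +
      2%:E * \int[mu]_t (normc (fourier_trunc n%:R g t - h2 t) ^+ 2)%:E @[n --> \oo] --> 0)%E.
    rewrite [X in _ --> X](_ : 0 = 2%:E * 0 + 2%:E * 0)%E; last by rewrite !mule0 adde0.
    by apply: cvgeD; [rewrite !mule0|apply: cvgeZl|apply: cvgeZl].
  rewrite -(cvg_lim _ lim12)//; apply: lime_ge; first by apply/cvg_ex; exists 0%E.
  apply: nearW => n.
  rewrite -ge0_integralZl//; [|exact: mF|by move=> t _; exact: (ge0 (fun t => _ - h1 t))].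
  rewrite -ge0_integralZl//; [|exact: mF|by move=> t _; exact: (ge0 (fun t => _ - h2 t))].
  rewrite -ge0_integralD//; last 4 first.
  - by move=> t _; rewrite mule_ge0//; exact: (ge0 (fun t => _ - h1 t)).
  - by apply: measurable_funeM; exact: mF.
  - by move=> t _; rewrite mule_ge0//; exact: (ge0 (fun t => _ - h2 t)).
  - by apply: measurable_funeM; exact: mF.
  apply: ge0_le_integral => //.
  - by move=> t _; exact: (ge0 (fun t => h1 t - h2 t)).
  - by apply: emeasurable_funD; apply: measurable_funeM; exact: mF.
  - by move=> t _; rewrite -!EFinM -EFinD lee_fin normcB_sqr_le.
have : (\int[mu]_t `|(normc (h1 t - h2 t) ^+ 2)%:E| = 0)%E.
  by rewrite -I0; apply: eq_integral => t _; rewrite gee0_abs// (ge0 (fun t => h1 t - h2 t)).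
move/(ae_eq_integral_abs mu measurableT m12); apply: ae_imply => t /(_ I) [] /eqP.
by rewrite sqrf_eq0 => /eqP/eq0_normc/eqP; rewrite subr_eq0 => /eqP.
Qed.

(** A chosen representative is in $L^2$ by [is_fourier], and so is the default value 0. *)
Lemma L2_fourier g : L2 (fourier g).
Proof.
rewrite /fourier; case: xgetP => [h _ []//|_].
split => /=; [exact: measurable_cst|exact: measurable_cst|].
under eq_integral do rewrite expr0n addr0 sqrtr0 expr0n.
by rewrite integral0 ltry.
Qed.

Lemma fourier_ae g h : L2 g -> is_fourier g h -> {ae mu, forall t, fourier g t = h t}.
Proof.
move=> gL2 gh; apply: (is_fourier_unique gL2 _ gh).
exact: (@xgetPex _ (fun=> 0) [set h | is_fourier g h] (ex_intro _ h gh)).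
Qed.

Definition inverse_fourier h x : R[i] :=
  cintegral setT (fun eta => cexpi (- (x * eta)) * h eta).

Section inversion.
Variables (u v : R) (h : R -> R[i]).
Let D := `[u, v]%classic : set R.
Hypotheses (hL2 : L2 h) (hD : {ae mu, forall t, ~ D t -> h t = 0}).
(** Cutting to [D] gives representatives that vanish everywhere outside [D], as [inversion_error]
    requires, whereas [h] does so only almost everywhere. *)
Let a : R -> R := (fun t => complex.Re (h t)) \_ D.
Let b : R -> R := (fun t => complex.Im (h t)) \_ D.

Let mD : measurable D. Proof. exact: measurable_itv. Qed.

Let aE t : D t -> a t = complex.Re (h t).
Proof. by move=> Dt; rewrite /a patchE mem_set. Qed.

Let bE t : D t -> b t = complex.Im (h t).
Proof. by move=> Dt; rewrite /b patchE mem_set. Qed.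

Let a0 t : ~ D t -> a t = 0.
Proof. by move=> nDt; rewrite /a patchE memNset. Qed.

Let b0 t : ~ D t -> b t = 0.
Proof. by move=> nDt; rewrite /b patchE memNset. Qed.

Let mr : measurable_fun setT (fun t => complex.Re (h t)). Proof. by case: hL2. Qed.
Let mi : measurable_fun setT (fun t => complex.Im (h t)). Proof. by case: hL2. Qed.

Let sqint_eq (c d : R -> R) : (forall t, D t -> c t = d t) -> sqint D d -> sqint D c.
Proof.
move=> cd [md id]; split.
  by apply: eq_measurable_fun md => t /set_mem Dt; rewrite cd.
by apply: eq_integrable id => // t /set_mem Dt; rewrite /= cd.
Qed.

Let sa : sqint D a. Proof. exact: sqint_eq aE (L2_sqint mD hL2).1. Qed.
Let sb : sqint D b. Proof. exact: sqint_eq bE (L2_sqint mD hL2).2. Qed.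
Let Dfin : (mu D < +oo)%E. Proof. exact: lebesgue_measure_itvcc_lty. Qed.
Let ia := sqint_integrable mD Dfin sa.
Let ib := sqint_integrable mD Dfin sb.

Let Re_inverse_fourier x : complex.Re (inverse_fourier h x) = cosT D a x + sinT D b x.
Proof.
rewrite /inverse_fourier /= (@Rintegral_ae_support D)//; last 2 first.
- under eq_fun do rewrite ReM /=; apply: measurable_funB; apply: measurable_funM => //.
    under eq_fun do rewrite cosN; exact: measurable_cosM.
  under eq_fun do rewrite sinN; apply: measurable_funN; exact: measurable_sinM.
- by apply: ae_imply hD => t h0 nDt; rewrite h0// mulr0.
rewrite -RintegralD//; [|exact: integrable_Mcos|exact: integrable_Msin].
apply: eq_Rintegral => t /set_mem Dt; rewrite ReM /= cosN sinN aE// bE//; ring.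
Qed.

Let Im_inverse_fourier x : complex.Im (inverse_fourier h x) = cosT D b x - sinT D a x.
Proof.
rewrite /inverse_fourier /= (@Rintegral_ae_support D)//; last 2 first.
- under eq_fun do rewrite ImM /=; apply: measurable_funD; apply: measurable_funM => //.
    under eq_fun do rewrite cosN; exact: measurable_cosM.
  under eq_fun do rewrite sinN; apply: measurable_funN; exact: measurable_sinM.
- by apply: ae_imply hD => t h0 nDt; rewrite h0// mulr0.
rewrite -RintegralB//; [|exact: integrable_Mcos|exact: integrable_Msin].
apply: eq_Rintegral => t /set_mem Dt; rewrite ImM /= cosN sinN aE// bE//; ring.
Qed.

Lemma L2_inverse_fourier : L2 (inverse_fourier h).
Proof.
split.
- under eq_fun do rewrite Re_inverse_fourier.
  by apply: continuous_measurable_fun; exact: (continuous_inverse_re sa sb).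
- under eq_fun do rewrite Im_inverse_fourier.
  by apply: continuous_measurable_fun; exact: (continuous_inverse_im sa sb).
- under eq_integral do rewrite sqr_normc Re_inverse_fourier Im_inverse_fourier.
  by rewrite (plancherel_inverse sa sb) ltry.
Qed.

Lemma is_fourier_inverse_fourier : is_fourier (inverse_fourier h) h.
Proof.
split; first exact: hL2.
have gL2 := L2_inverse_fourier.
pose Q := \int[mu]_(x in D) (a x ^+ 2 + b x ^+ 2).
pose J (n : nat) := \int[mu]_(x in `[- n%:R, n%:R])
  ((cosT D a x + sinT D b x) ^+ 2 + (cosT D b x - sinT D a x) ^+ 2).
have -> : (fun n : nat => \int[mu]_t (normc (fourier_trunc n%:R (inverse_fourier h) t - h t) ^+ 2)%:E)%E
    = (fun n : nat => (Q - (2 * pi)^-1 * J n)%:E).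
  apply/funext => n; rewrite /Q /J -(inversion_error sa sb n a0 b0).
  have mF1 := measurable_Re_fourier_trunc n gL2.
  have mF2 := measurable_Im_fourier_trunc n gL2.
  pose X t := complex.Re (fourier_trunc n%:R (inverse_fourier h) t).
  pose Y t := complex.Im (fourier_trunc n%:R (inverse_fourier h) t).
  transitivity (\int[mu]_t ((X t - a t) ^+ 2 + (Y t - b t) ^+ 2)%:E)%E.
    apply: ge0_ae_eq_integral => //.
    - apply: measurable_sqr_normc.
        by under eq_fun do rewrite ReB; exact: measurable_funB.
      by under eq_fun do rewrite ImB; exact: measurable_funB.
    - have ma : measurable_fun setT a.
        exact/(measurable_restrict _ mD measurableT)/measurable_funTS.
      have mb : measurable_fun setT b.
        exact/(measurable_restrict _ mD measurableT)/measurable_funTS.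
      apply/measurable_EFinP; apply: measurable_funD; apply: measurable_funX;
        exact: measurable_funB.
    - by move=> t _; rewrite lee_fin sqr_ge0.
    - by move=> t _; rewrite lee_fin addr_ge0 ?sqr_ge0.
    - apply: ae_imply hD => t h0 _; rewrite sqr_normc ReB ImB -/(X t) -/(Y t).
      have [Dt|nDt] := pselect (D t); first by rewrite aE// bE.
      by rewrite a0// b0// h0.
  apply: eq_integral => t _.
  rewrite /X /Y Re_fourier_trunc// Im_fourier_trunc//.
  have -> : (fun x => complex.Re (inverse_fourier h x)) = (fun x => cosT D a x + sinT D b x).
    by apply/funext => x; rewrite Re_inverse_fourier.
  have -> // : (fun x => complex.Im (inverse_fourier h x)) = (fun x => cosT D b x - sinT D a x).
  by apply/funext => x; rewrite Im_inverse_fourier.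
apply: cvg_EFin; first exact: nearW.
(* The limit of [J n] is [2 * pi * Q], by Plancherel for the inverse transform. *)
have -> : 0 = Q - (2 * pi)^-1 * (2 * pi * Q) :> R.
  by rewrite mulKf ?subrr// mulf_neq0// gt_eqF// pi_gt0.
apply: cvgB; first exact: cvg_cst.
apply: cvgM; first exact: cvg_cst.
exact: (cvg_plancherel_inverse sa sb).
Qed.

Lemma fourier_inverse_fourier : {ae mu, forall t, fourier (inverse_fourier h) t = h t}.
Proof. exact: fourier_ae L2_inverse_fourier is_fourier_inverse_fourier. Qed.

End inversion.

End fourier_inversion.

(** * Truncation of the backward heat flow *)

Section inverse_fourier_linearity.
Context {R : realType}.
Local Notation mu := (@lebesgue_measure R).
Implicit Types (h k : R -> R[i]) (phi : R -> R) (x u v c : R).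

Lemma integrable_ae_support (D : set R) (f : R -> R) : measurable D ->
  measurable_fun setT f -> {ae mu, forall x, ~ D x -> f x = 0} ->
  mu.-integrable D (EFin \o f) -> mu.-integrable setT (EFin \o f).
Proof.
move=> mD mf f0 /integrableP[_ foo]; apply/integrableP; split.
  exact/measurable_EFinP.
have mnf : measurable_fun setT (fun x => `|(f x)%:E|)%E.
  by apply/measurable_EFinP; exact: measurableT_comp.
rewrite (_ : (\int[mu]_x _ = \int[mu]_(x in D) `|(f x)%:E|)%E)//.
rewrite [RHS]integral_mkcond; apply: ge0_ae_eq_integral => //.
- by apply/(measurable_restrict _ mD measurableT); exact: measurable_funTS.
- by move=> x _; rewrite patchE; case: ifPn.
- apply: ae_imply f0 => x f0 _; rewrite patchE; case: ifPn => // /negP nDx.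
  by rewrite /= f0 ?normr0// => Dx; apply: nDx; exact/mem_set.
Qed.

Section support.
Variables (u v : R).
Let D := `[u, v]%classic : set R.
Let mD : measurable D. Proof. exact: measurable_itv. Qed.
Let Dfin : (mu D < +oo)%E. Proof. exact: lebesgue_measure_itvcc_lty. Qed.

(* For such functions the integrals defining [inverse_fourier] converge absolutely. *)
Definition L2_support h := L2 h /\ {ae mu, forall t, ~ D t -> h t = 0}.

Lemma integrable_Re_inverse h x : L2_support h ->
  mu.-integrable setT (EFin \o (fun t => complex.Re (cexpi (- (x * t)) * h t))).
Proof.
move=> [hL2 h0]; have [mr mi _] := hL2; have [sr si] := L2_sqint mD hL2.
have ir := sqint_integrable mD Dfin sr; have ii := sqint_integrable mD Dfin si.
have eq : (fun t => complex.Re (cexpi (- (x * t)) * h t)) =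
    (fun t => complex.Re (h t) * cos (x * t) + complex.Im (h t) * sin (x * t)).
  by apply/funext => t; rewrite ReM /= cosN sinN; ring.
apply: (@integrable_ae_support D) => //.
- rewrite eq; apply: measurable_funD; apply: measurable_funM => //.
    exact: measurable_cosM.
  exact: measurable_sinM.
- by apply: ae_imply h0 => t h0 nDt; rewrite h0// mulr0.
- rewrite eq; apply: integrable_EFinD => //; first exact: integrable_Mcos.
  exact: integrable_Msin.
Qed.

Lemma integrable_Im_inverse h x : L2_support h ->
  mu.-integrable setT (EFin \o (fun t => complex.Im (cexpi (- (x * t)) * h t))).
Proof.
move=> [hL2 h0]; have [mr mi _] := hL2; have [sr si] := L2_sqint mD hL2.
have ir := sqint_integrable mD Dfin sr; have ii := sqint_integrable mD Dfin si.
have eq : (fun t => complex.Im (cexpi (- (x * t)) * h t)) =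
    (fun t => complex.Im (h t) * cos (x * t) - complex.Re (h t) * sin (x * t)).
  by apply/funext => t; rewrite ImM /= cosN sinN; ring.
apply: (@integrable_ae_support D) => //.
- rewrite eq; apply: measurable_funB; apply: measurable_funM => //.
    exact: measurable_cosM.
  exact: measurable_sinM.
- by apply: ae_imply h0 => t h0 nDt; rewrite h0// mulr0.
- rewrite eq; apply: integrable_EFinB => //; first exact: integrable_Mcos.
  exact: integrable_Msin.
Qed.

Lemma inverse_fourierZ c h x : L2_support h ->
  inverse_fourier (fun t => c%:C * h t) x = c%:C * inverse_fourier h x.
Proof.
move=> sh; have ir := integrable_Re_inverse x sh; have ii := integrable_Im_inverse x sh.
apply/eqP; rewrite eq_complex ReM ImM /= !mul0r subr0 addr0; apply/andP; split; apply/eqP.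
- rewrite -RintegralZl//; apply: eq_Rintegral => t _.
  by rewrite mulrCA ReM /= mul0r subr0.
- rewrite -RintegralZl//; apply: eq_Rintegral => t _.
  by rewrite mulrCA ImM /= mul0r addr0.
Qed.

Lemma inverse_fourierB h k x : L2_support h -> L2_support k ->
  inverse_fourier (fun t => h t - k t) x = inverse_fourier h x - inverse_fourier k x.
Proof.
move=> sh sk.
have hr := integrable_Re_inverse x sh; have hi := integrable_Im_inverse x sh.
have kr := integrable_Re_inverse x sk; have ki := integrable_Im_inverse x sk.
apply/eqP; rewrite eq_complex ReB ImB /=; apply/andP; split; apply/eqP.
- rewrite -RintegralB//; apply: eq_Rintegral => t _.
  by rewrite mulrBr ReB.
- rewrite -RintegralB//; apply: eq_Rintegral => t _.
  by rewrite mulrBr ImB.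
Qed.

Lemma sqr_normc_scale c (z : R[i]) : normc (c%:C * z) ^+ 2 = c ^+ 2 * normc z ^+ 2.
Proof. rewrite !sqr_normc ReM ImM /=; ring. Qed.

(** A bound on [D] is enough because [h] vanishes almost everywhere elsewhere. This matters for the
    backward heat factor, which is unbounded on the line when [t < T]. *)
Lemma L2_supportM phi h B : measurable_fun setT phi ->
  (forall t, D t -> `|phi t| <= B) -> L2_support h ->
  L2_support (fun t => (phi t)%:C * h t).
Proof.
move=> mphi phiB [[mr mi hoo] h0].
have mr' : measurable_fun setT (fun t => complex.Re ((phi t)%:C * h t)).
  by under eq_fun do rewrite ReM /= mul0r subr0; exact: measurable_funM.
have mi' : measurable_fun setT (fun t => complex.Im ((phi t)%:C * h t)).
  by under eq_fun do rewrite ImM /= mul0r addr0; exact: measurable_funM.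
split; last by apply: ae_imply h0 => t h0 nDt; rewrite h0// mulr0.
split => //; apply: (@le_lt_trans _ _ (\int[mu]_t ((B ^+ 2)%:E * (normc (h t) ^+ 2)%:E))%E).
  apply: ae_ge0_le_integral => //.
  - by move=> t _; rewrite lee_fin sqr_ge0.
  - exact: measurable_sqr_normc.
  - by move=> t _; rewrite -EFinM lee_fin mulr_ge0 ?sqr_ge0.
  - by apply: measurable_funeM; exact: measurable_sqr_normc.
  - apply: ae_imply h0 => t h0 _; rewrite -EFinM lee_fin sqr_normc_scale.
    have [Dt|nDt] := pselect (D t); last first.
      by rewrite h0// sqr_normc /= expr0n/= addr0 !mulr0.
    rewrite ler_wpM2r ?sqr_ge0// -(real_normK (num_real (phi t))).
    by rewrite ler_sqr ?nnegrE ?phiB// (le_trans _ (phiB _ Dt)).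
rewrite ge0_integralZl//.
- by rewrite lte_mul_pinfty// lee_fin sqr_ge0.
- exact: measurable_sqr_normc.
- by move=> t _; rewrite lee_fin sqr_ge0.
- by rewrite lee_fin sqr_ge0.
Qed.

End support.

Lemma integral_expRN_itvy (p : R) :
  (\int[mu]_(q in `[p, +oo[) (expR (- q))%:E = (expR (- p))%:E)%E.
Proof.
pose F (q : R) := - expR (- q).
have dF (q : R) : is_derive q 1 F (expR (- q)).
  by rewrite /F; apply: is_derive_eq; rewrite /GRing.scale/= mulrN1 opprK.
rewrite (@ge0_continuous_FTC2y _ _ F _ 0).
- by rewrite /F sub0e EFinN oppeK.
- by move=> t _; exact: expR_ge0.
- apply: continuous_subspaceT => q; apply: (@continuous_comp R R R -%R expR).
    exact: oppr_continuous.
  exact: continuous_expR.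
- by rewrite /F -[X in _ --> X]oppr0; apply: cvgN; exact: cvgr_expR.
- by move=> t _; have [] := dF t.
- by apply: cvg_at_right_filter; exact: (continuous_is_derive dF).
- by move=> t _; rewrite derive1E derive_val.
Qed.

Lemma Rintegral_expRN_itvyM (p c : R) :
  \int[mu]_(q in `[p, +oo[) (expR (- q) * c) = expR (- p) * c.
Proof.
rewrite RintegralZr//.
  by rewrite /Rintegral integral_expRN_itvy.
apply/integrableP; split.
  apply/measurable_EFinP; apply: measurable_funTS; apply: measurableT_comp => //.
under eq_integral do rewrite /= ger0_norm ?expR_ge0//.
by rewrite integral_expRN_itvy ltry.
Qed.

End inverse_fourier_linearity.

(** * Low and high frequencies of the backward heat flow *)

Section heat.
Context {R : realType}.
Local Notation mu := (@lebesgue_measure R).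
Variables (T : R) (uT : R -> R[i]) (L M : R).
Local Notation D := (`[- L, L]%classic : set R).
Hypothesis uT_support : {ae mu, forall t, ~ D t -> fourier uT t = 0}.

Let heat_factor (t eta : R) := expR (eta ^+ 2 * (T - t)).

Let low (eta : R) : R := \1_(`[- M, M]%classic : set R) eta.

Let measurable_heat_factor t : measurable_fun setT (heat_factor t).
Proof.
by apply: measurableT_comp => //; exact: measurable_funM.
Qed.

Let measurable_low : measurable_fun setT low.
Proof. exact: measurable_indic. Qed.

Let low_norm eta : `|low eta| <= 1.
Proof. by rewrite /low indicE; case: (_ \in _); rewrite ?normr1 ?normr0. Qed.

Let heat_factor_le t eta : t <= T -> D eta -> `|heat_factor t eta| <= expR (L ^+ 2 * (T - t)).
Proof.
move=> tT; rewrite /= in_itv/= -ler_norml => etaL.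
rewrite ger0_norm ?expR_ge0// ler_expR ler_wpM2r ?subr_ge0//.
rewrite -(real_normK (num_real eta)) ler_sqr ?nnegrE//.
exact: le_trans etaL.
Qed.

Let sU : L2_support (- L) L (fourier uT).
Proof. by split; [exact: L2_fourier|exact: uT_support]. Qed.

(** [full], [trunc] and [high] are the frequency-side densities of the solution, of its recovered
    version, and of their difference. *)
Let full t (eta : R) := (heat_factor t eta)%:C * fourier uT eta.
Let trunc t (eta : R) := (low eta)%:C * full t eta.
Let high t (eta : R) := full t eta - trunc t eta.

Let s_full t : t <= T -> L2_support (- L) L (full t).
Proof.
move=> tT; apply: (@L2_supportM _ _ _ _ _ (expR (L ^+ 2 * (T - t))) _ _ sU).
  exact: measurable_heat_factor.
by move=> eta; exact: heat_factor_le.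
Qed.

Let s_trunc t : t <= T -> L2_support (- L) L (trunc t).
Proof.
by move=> tT; apply: (L2_supportM _ _ (s_full tT)) => // eta _; exact: low_norm.
Qed.

(** As a multiplier of [full], the difference falls under [L2_supportM], and it visibly vanishes for
    frequencies up to [M]. *)
Let highE t : high t = (fun eta => (1 - low eta)%:C * full t eta).
Proof.
apply/funext => eta; rewrite /high /trunc.
by apply/eqP; rewrite eq_complex ReB ImB !ReM !ImM /=; apply/andP; split; apply/eqP; ring.
Qed.

Let s_high t : t <= T -> L2_support (- L) L (high t).
Proof.
move=> tT; rewrite highE; apply: (@L2_supportM _ _ _ _ _ 2 _ _ (s_full tT)).
  exact: measurable_funB.
move=> eta _; rewrite (le_trans (ler_normB _ _))// normr1.
by have := low_norm eta; lra.
Qed.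

Lemma heat_backwardE t x : heat_backward T uT t x = inverse_fourier (full t) x.
Proof.
by rewrite /heat_backward /inverse_fourier; congr cintegral; apply/funext => eta; rewrite mulrA.
Qed.

Lemma w_maxE t x p : 0 <= t <= T -> M ^+ 2 * T < p ->
  w_max T uT M t x p = (expR (- p))%:C * inverse_fourier (trunc t) x.
Proof.
move=> /andP[t0 tT] pM; rewrite -(inverse_fourierZ _ _ (s_trunc tT)).
rewrite /w_max /inverse_fourier; congr cintegral; apply/funext => eta.
rewrite [RHS]mulrC; congr (_ * _); rewrite /trunc /full /low indicE.
case: (boolP (_ \in _)); last by rewrite !rmorph0 mul0r !mulr0.
rewrite !rmorph1 mulr1 mul1r inE/= in_itv/= -ler_norml => etaM.
rewrite mulrA; congr (_ * _).
have h1 : eta ^+ 2 <= M ^+ 2.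
  rewrite -(real_normK (num_real eta)) ler_sqr ?nnegrE//.
  exact: le_trans etaM.
(* The threshold on [p] is used here: on the retained frequencies the absolute value opens with a
   positive sign, so the exponential splits into $e^{-p}$ times the heat factor. *)
have h2 : 0 <= p + eta ^+ 2 * (t - T).
  have : eta ^+ 2 * (T - t) <= M ^+ 2 * T.
    by rewrite ler_pM ?sqr_ge0// ?subr_ge0// lerBlDr lerDl.
  by move: pM; lra.
rewrite ger0_norm// -rmorphM /= -expRD; congr (_%:C); congr expR; rewrite /heat_factor.
by ring.
Qed.

Lemma u_max_pointE t x p : 0 <= t <= T -> M ^+ 2 * T < p ->
  u_max_point T uT M t x p = inverse_fourier (trunc t) x.
Proof.
move=> tT pM; rewrite /u_max_point w_maxE// mulrA -rmorphM /= -expRD subrr expR0.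
by rewrite mul1r.
Qed.

(* By [w_maxE], [w_max] is a multiple of [expR (- q)] for [q >= p]. *)
Lemma u_max_intE t x p : 0 <= t <= T -> M ^+ 2 * T < p ->
  u_max_int T uT M t x p = inverse_fourier (trunc t) x.
Proof.
move=> tT pM; set z := inverse_fourier _ _.
rewrite /u_max_int (_ : cintegral _ _ = (expR (- p))%:C * z).
  by rewrite mulrA -rmorphM /= -expRD subrr expR0 mul1r.
have wE q : q \in (`[p, +oo[%classic : set R) -> w_max T uT M t x q = (expR (- q))%:C * z.
  rewrite inE/= in_itv/= andbT => pq.
  by rewrite w_maxE//; exact: lt_le_trans pq.
clearbody z; apply/eqP; rewrite eq_complex; apply/andP; split; apply/eqP.
- transitivity (\int[mu]_(q in `[p, +oo[) (expR (- q) * complex.Re z)).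
    by apply: eq_Rintegral => q qp; rewrite wE// ReM /= mul0r subr0.
  by rewrite Rintegral_expRN_itvyM ReM /= mul0r subr0.
- transitivity (\int[mu]_(q in `[p, +oo[) (expR (- q) * complex.Im z)).
    by apply: eq_Rintegral => q qp; rewrite wE// ImM /= mul0r addr0.
  by rewrite Rintegral_expRN_itvyM ImM /= mul0r addr0.
Qed.

Let high_gain (s t eta : R) : 0 <= s -> 0 < M -> 0 <= t -> M < `|eta| ->
  (1 - low eta) ^+ 2 * heat_factor t eta ^+ 2 <=
  (expR (- (M ^+ 2 * t)) * (M `^ s)^-1) ^+ 2 *
    (heat_factor 0 eta ^+ 2 * (1 + eta ^+ 2) `^ s).
Proof.
move=> s0 M0 t0 Meta.
have -> : low eta = 0.
  by rewrite /low indicE memNset// /= in_itv/= -ler_norml leNgt Meta.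
have h2 : M ^+ 2 <= eta ^+ 2.
  by rewrite -(real_normK (num_real eta)) ler_sqr ?nnegrE// ltW.
have Ms : 0 < M `^ s by exact: powR_gt0.
have h1 : heat_factor t eta <= expR (- (M ^+ 2 * t)) * heat_factor 0 eta.
  rewrite /heat_factor -expRD ler_expR subr0 mulrBr.
  by have := ler_wpM2r t0 h2; lra.
(* The left side is $(M^2)^s$, and the power with exponent [s >= 0] is monotone. *)
have h3 : (M `^ s) ^+ 2 <= (1 + eta ^+ 2) `^ s.
  rewrite expr2 -powRM ?(ltW M0)// -expr2; apply: ge0_ler_powR => //.
  - by rewrite nnegrE sqr_ge0.
  - by rewrite nnegrE addr_ge0 ?sqr_ge0.
  - by rewrite (le_trans h2)// lerDr.
rewrite subr0 expr1n mul1r.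
apply: (@le_trans _ _ ((expR (- (M ^+ 2 * t)) * heat_factor 0 eta) ^+ 2)).
  by rewrite ler_sqr ?nnegrE// ?mulr_ge0 ?expR_ge0.
have h4 : 1 <= (M `^ s)^-1 ^+ 2 * (1 + eta ^+ 2) `^ s.
  by rewrite exprVn mulrC ler_pdivlMr ?exprn_gt0// mul1r.
rewrite [leLHS]exprMn [(_ / _) ^+ 2]exprMn; move: h4; set V := (M `^ s)^-1 ^+ 2; set W := _ `^ s.
move: (expR _ ^+ 2) (heat_factor 0 eta ^+ 2) (sqr_ge0 (expR (- (M ^+ 2 * t))))
  (sqr_ge0 (heat_factor 0 eta)) => E H E0 H0 VW.
have -> : E * V * (H * W) = E * H * (V * W) by ring.
by apply: ler_peMr VW; exact: mulr_ge0.
Qed.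

(** By Fourier inversion the transforms in both norms agree almost everywhere with the densities
    [high t] and [full 0], so that the pointwise bound [high_gain] can be integrated. *)
Lemma heat_truncation_error (s t : R) : 0 <= s -> 0 < M -> 0 <= t <= T ->
  (L2_norm (inverse_fourier (high t)) <=
   (expR (- (M ^+ 2 * t)))%:E * delta T s uT M * ((M `^ s)^-1)%:E)%E.
Proof.
move=> s0 M0 /andP[t0 tT].
have T0 : 0 <= T by exact: le_trans tT.
have [hL2 hD] := s_high tT; have [fL2 fD] := s_full T0.
have hbE : heat_backward T uT 0 = inverse_fourier (full 0).
  by apply/funext => x; exact: heat_backwardE.
rewrite /L2_norm /Hs_norm asboolT; last exact: (L2_inverse_fourier hL2 hD).
rewrite /delta hbE.
have Fh := fourier_inverse_fourier hL2 hD.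
have Ff := fourier_inverse_fourier fL2 fD.
set F1 := fourier (inverse_fourier (high t)) in Fh *.
set F0 := fourier (inverse_fourier (full 0)) in Ff *.
have [mr1 mi1 _] : L2 F1 by exact: L2_fourier.
have [mr0 mi0 _] : L2 F0 by exact: L2_fourier.
pose C := expR (- (M ^+ 2 * t)) * (M `^ s)^-1.
have C0 : 0 <= C by rewrite mulr_ge0 ?expR_ge0// invr_ge0 powR_ge0.
pose S := [set eta : R | M < `|eta|].
have mS : measurable S.
  rewrite (_ : S = ~` (`[- M, M]%classic : set R)); first exact: measurableC.
  apply/seteqP; split => x; rewrite /S/= in_itv/= -ler_norml.
    by move=> Mx; apply/negP; rewrite -ltNge.
  by move=> /negP; rewrite -ltNge.
rewrite muleAC -EFinM -/C.
(* With the constant moved under the root, both sides are square roots and only the integrals have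
   to be compared. *)
have -> : C%:E = sqrte ((C ^+ 2)%:E) by rewrite /= sqrtr_sqr ger0_norm.
have C20 : (0 <= (C ^+ 2)%:E)%E by rewrite lee_fin sqr_ge0.
have mw (r : R) : measurable_fun setT (fun eta : R => (1 + eta ^+ 2) `^ r).
  apply: (measurableT_comp (measurable_powR r)).
  by apply: measurable_funD => //; exact: measurable_funX.
have m1 (r : R) (F : R -> R[i]) : measurable_fun setT (fun x => complex.Re (F x)) ->
    measurable_fun setT (fun x => complex.Im (F x)) ->
    measurable_fun setT (fun eta => (normc (F eta) ^+ 2 * (1 + eta ^+ 2) `^ r)%:E).
  move=> mr mi; apply/measurable_EFinP; apply: measurable_funM => //.
  by apply/measurable_EFinP; exact: measurable_sqr_normc.
have ge0 (r : R) (F : R -> R[i]) eta : (0 <= (normc (F eta) ^+ 2 * (1 + eta ^+ 2) `^ r)%:E)%E.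
  by rewrite lee_fin mulr_ge0 ?sqr_ge0 ?powR_ge0.
rewrite /weighted_norm -sqrteM// lee_sqrt; last by rewrite mule_ge0// integral_ge0.
rewrite -ge0_integralZl//; last exact: measurable_funTS (m1 s F0 mr0 mi0).
(* The right side is extended by zero from [S] to the line, where the left integral lives. *)
rewrite [leRHS]integral_mkcond.
apply: ae_ge0_le_integral => //.
- exact: (m1 0 F1 mr1 mi1).
- move=> eta _; rewrite patchE; case: ifPn => // _.
  exact: mule_ge0 C20 (ge0 s F0 eta).
- apply/(measurable_restrict _ mS measurableT); apply: measurable_funTS.
  exact: measurable_funeM (m1 s F0 mr0 mi0).
apply: (ae_imply2 _ Fh Ff) => eta F1E F0E _.
rewrite patchE F1E F0E powRr0 mulr1 highE.
rewrite sqr_normc_scale; case: ifPn => [|/negP nS].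
  rewrite inE => Meta; rewrite -EFinM lee_fin /full !sqr_normc_scale.
  rewrite mulrA [leRHS](_ : _ = C ^+ 2 * (heat_factor 0 eta ^+ 2 * (1 + eta ^+ 2) `^ s) *
    normc (fourier uT eta) ^+ 2); last by ring.
  by rewrite ler_wpM2r ?sqr_ge0// high_gain.
(* Outside [S] the right side is 0, and so is the left one because nothing was truncated there. *)
have -> : low eta = 1.
  rewrite /low indicE mem_set//= in_itv/= -ler_norml leNgt; apply/negP => Meta.
  by apply: nS; rewrite inE.
by rewrite subrr expr0n /= mul0r.
Qed.

Lemma heat_error_point (s t p : R) : 0 <= s -> 0 < M -> 0 <= t <= T -> M ^+ 2 * T < p ->
  (L2_norm (fun x => (heat_backward T uT t x - u_max_point T uT M t x p)%R) <=
   (expR (- (M ^+ 2 * t)))%:E * delta T s uT M * ((M `^ s)^-1)%:E)%E.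
Proof.
move=> s0 M0 tT pM; have /andP[_ tT'] := tT.
have -> : (fun x => heat_backward T uT t x - u_max_point T uT M t x p) =
    inverse_fourier (high t).
  apply/funext => x; rewrite heat_backwardE u_max_pointE//.
  by rewrite -(inverse_fourierB _ (s_full tT') (s_trunc tT')).
exact: heat_truncation_error.
Qed.

End heat.

(** Both recovery formulas give the inverse transform of the same truncated density, so the estimate
    for one covers the other. *)
Lemma u_max_int_pointE (R : realType) (T L M : R) (uT : R -> R[i]) (t x p : R) :
  {ae @lebesgue_measure R, forall eta, ~ (`[- L, L]%classic : set R) eta -> fourier uT eta = 0} ->
  0 <= t <= T -> M ^+ 2 * T < p ->
  u_max_int T uT M t x p = u_max_point T uT M t x p.
Proof. by move=> h tT pM; rewrite (u_max_intE h)// (u_max_pointE h). Qed.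

Lemma compactly_supported_itv (R : realType) (h : R -> R[i]) : compactly_supported h ->
  exists L : R, {ae @lebesgue_measure R, forall eta, ~ (`[- L, L]%classic : set R) eta -> h eta = 0}.
Proof.
(* Boundedness provides a bound by every number strictly above [B]; [B + 1] is one. *)
move=> [K /compact_bounded[B [_ /(_ (B + 1))]]]; rewrite ltrDl ltr01 => /(_ isT) KB h0.
exists (B + 1); apply: ae_imply h0 => eta h0 nD; apply: h0 => /KB etaB; apply: nD.
by rewrite /= in_itv/= -ler_norml.
Qed.

Local Close Scope complex_scope.

Theorem theorem3p1 (R : realType) (T s : R) (uT : R -> R[i]) (etamax : R)
    (u_etamax : R -> R -> R -> R[i]) :
  0 < T -> 1 <= s ->
  in_Hs s uT -> compactly_supported (fourier uT) ->
  0 < etamax ->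
  u_etamax = u_max_point T uT etamax \/ u_etamax = u_max_int T uT etamax ->
  forall p : R, etamax ^+ 2 * T < p ->
  forall t : R, 0 <= t < T ->
  (L2_norm (fun x => (heat_backward T uT t x - u_etamax t x p)%R)
    <= (expR (- (etamax ^+ 2 * t)))%:E * delta T s uT etamax
       * ((etamax `^ s)^-1)%:E)%E.
Proof.
move=> _ s1 _ /compactly_supported_itv[L uT0] M0 uE p pM t /andP[t0 tT].
have s0 : 0 <= s by exact: le_trans s1.
have ttT : 0 <= t <= T by rewrite t0 ltW.
have -> : (fun x => heat_backward T uT t x - u_etamax t x p) =
    (fun x => heat_backward T uT t x - u_max_point T uT etamax t x p).
  by apply/funext => x; case: uE => -> //; rewrite (u_max_int_pointE _ uT0).
exact: (heat_error_point uT0).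
Qed.
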